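(* Let $\phi:\mathbb{N}\to\mathbb{N}$ be weakly order-preserving and $\lambda,\mu$ partitions with $n$ parts such that $\phi(\lambda)=\mu$. Let $\mathrm{inc}(\lambda,\phi)$ be the lexicographically smallest $\zeta\in S_\lambda$ with $\phi(\zeta)=\mu$. Then at $q=1$, $E_{\mathrm{inc}(\lambda,\phi)}(\mathbf{x};1,t)$ is a symmetric-function multiple of $E_\mu(\mathbf{x};1,t)=F_\mu(\mathbf{x};1,t)$; that is, $E_{\mathrm{inc}(\lambda,\phi)}(\mathbf{x};1,t)/E_\mu(\mathbf{x};1,t)$ is symmetric in $x_1,\dots,x_n$.
   Context: $\phi$ is weakly order-preserving if $\phi(i)\le\phi(j)$ whenever $i\le j$; $\phi(\rho)=(\phi(\rho_1),\dots,\phi(\rho_n))$. $S_\lambda$ is the set of compositions rearranging $\lambda$. Operators: for $f\in\mathbb{Q}(q,t)[x_1,\dots,x_n]$, $s_if$ swaps $x_i,x_{i+1}$; $L_if=\frac{tx_i-x_{i+1}}{x_i-x_{i+1}}(f-s_if)$; $T_if=tf-L_if$; $T_i^{-1}f=t^{-1}f-t^{-1}L_if$; $(\omega f)(x_1,\dots,x_n)=f(qx_n,x_1,\dots,x_{n-1})$; $Y_i=t^{-(i-1)}T_i^{-1}\cdots T_{n-1}^{-1}\omega T_1\cdots T_{i-1}$. For a composition $\eta$, $y_i(\eta)=q^{\eta_i}t^{-\#\{j>i:\eta_j\ge\eta_i\}-\#\{j<i:\eta_j>\eta_i\}}$. With $\eta^+$ the decreasing rearrangement, $\eta\le\nu$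 means $\eta^+\le\nu^+$ in dominance order, or $\eta^+=\nu^+$ and $\eta_1+\dots+\eta_i\le\nu_1+\dots+\nu_i$ for all $i$. $E_\eta(\mathbf{x};q,t)$ is the unique polynomial $\sum_{\zeta\le\eta}v_{\eta,\zeta}\mathbf{x}^\zeta$ with $v_{\eta,\eta}=1$ and $Y_iE_\eta=y_i(\eta)E_\eta$ for all $i$. The ASEP polynomial $F_\mu$ of the partition $\mu$ is by definition equal to $E_\mu$. *)

(* Defs.v *)
From HB Require Import structures.
From mathcomp Require Import all_boot all_order all_fingroup all_algebra.
From mathcomp Require Import mpoly.

Set Implicit Arguments.
Unset Strict Implicit.
Unset Printing Implicit Defensive.

Import Order.TTheory GRing.Theory.
Local Open Scope ring_scope.

Notation "x %:F" := (@FracField.tofrac _ x) : ring_scope.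

(* Q(t) is the fraction field of Q[t], and Q(q,t) the fraction field of        *)
(* Q[t][q]: the outer variable is q and the inner one is t.                    *)
Definition Qt : fieldType := {fraction {poly rat}}.
Definition Qqt : fieldType := {fraction {poly {poly rat}}}.

Definition q_ : Qqt := ('X : {poly {poly rat}})%:F.
Definition t_ : Qqt := (('X : {poly rat})%:P : {poly {poly rat}})%:F.

(* Compositions with n nonnegative parts, and partitions padded with zeros to  *)
(* n parts, are exponent vectors 'X_{1..n}; indices are 0-based throughout.    *)
Section Compositions.
Variable n : nat.
Implicit Types eta nu lam mu zeta : 'X_{1..n}.

Definition is_part lam : Prop := forall i j : 'I_n, (i <= j)%N -> (lam j <= lam i)%N.

Definition rearr lam zeta : bool := perm_eq zeta lam.

Definition mapc (phi : nat -> nat) eta : 'X_{1..n} := [multinom phi (eta i) | i < n].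

Definition lex_le eta nu : bool := ((eta : seqlexi nat) <= (nu : seqlexi nat))%O.

Definition is_inc (phi : nat -> nat) lam mu zeta : Prop :=
  [/\ rearr lam zeta, mapc phi zeta = mu
    & forall zeta', rearr lam zeta' -> mapc phi zeta' = mu -> lex_le zeta zeta'].

Definition decr eta : seq nat := sort geq eta.

Definition psums_le (s s' : seq nat) : Prop :=
  forall k, (sumn (take k s) <= sumn (take k s'))%N.

Definition dominance_le (s s' : seq nat) : Prop :=
  sumn s = sumn s' /\ psums_le s s'.

(* Both clauses are non-strict, so this is only a preorder. With the first     *)
(* clause made strict there is no E_(0,1) for n = 2: the eigenfunction is      *)
(* x_2 + (t - 1) / (q t - 1) x_1. The support condition is used only as a      *)
(* hypothesis, so the present, larger relation is the less restrictive choice. *)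
Definition comp_le eta nu : Prop :=
  dominance_le (decr eta) (decr nu) \/ decr eta = decr nu /\ psums_le eta nu.

Definition eigval eta (i : 'I_n) : Qqt :=
  q_ ^+ eta i
  * t_ ^- (#|[set j : 'I_n | (i < j)%N && (eta i <= eta j)%N]|
           + #|[set j : 'I_n | (j < i)%N && (eta i < eta j)%N]|).

End Compositions.

Section DividedDifference.
Variables (K : fieldType) (n : nat).
Implicit Types (f g : {mpoly K[n]}) (i j : 'I_n).

Lemma divdiff_ex i j f :
  exists g, ('X_i - 'X_j) * g == f - msym (tperm i j) f.
Proof.
suff [g Hg] : exists g, ('X_i - 'X_j) * g = f - msym (tperm i j) f.
  by exists g; apply/eqP.
pose s := tperm i j.
pose P f := exists g, ('X_i - 'X_j) * g = f - msym s f.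
have PD f1 f2 : P f1 -> P f2 -> P (f1 + f2).
  move=> [g1 H1] [g2 H2]; exists (g1 + g2).
  by rewrite mulrDr H1 H2 msymD opprD addrACA.
have PZ c f1 : P f1 -> P (c *: f1).
  by move=> [g1 H1]; exists (c *: g1); rewrite -scalerAr H1 msymZ scalerBr.
have PM f1 f2 : P f1 -> P f2 -> P (f1 * f2).
  move=> [g1 H1] [g2 H2]; exists (g1 * f2 + msym s f1 * g2).
  rewrite mulrDr mulrA H1 mulrCA H2 msymM mulrBl mulrBr addrA.
  by rewrite subrK.
have P1 : P 1 by exists 0; rewrite mulr0 msym1 subrr.
have PX k : P 'X_k.
  rewrite /P; have -> : msym s 'X_k = 'X_(s k) :> {mpoly K[n]}.
    rewrite /msym mmapX mmap1U //.
  rewrite /s; case: tpermP => [->|->|_ _].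
  - by exists 1; rewrite mulr1.
  - by exists (-1); rewrite mulrN1 opprB.
  - by exists 0; rewrite mulr0 subrr.
rewrite -/(P f); rewrite [f]mpolyE.
elim/big_rec: _ => [|m g _ Pg]; first by exists 0; rewrite mulr0 msym0 subrr.
apply: (PD) => //; apply: (PZ); rewrite mpolyXE_id.
elim/big_rec: _ => // k h _ Ph; apply: (PM) => //.
by elim: (m k) => [|e IH]; rewrite ?expr0 // exprS; apply: (PM).
Qed.

(* (f - s f) / (x_i - x_j), with s the exchange of x_i and x_j, as a polynomial *)
Definition divdiff i j f : {mpoly K[n]} := xchoose (divdiff_ex i j f).

Lemma divdiffP i j f :
  ('X_i - 'X_j) * divdiff i j f = f - msym (tperm i j) f.
Proof. exact/eqP/(xchooseP (divdiff_ex i j f)). Qed.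

End DividedDifference.

Section Operators.
Variable n : nat.
Implicit Types (f : {mpoly Qqt[n]}) (i k : 'I_n).

(* ordS and ord_pred are cyclic on 'I_n; the operators L, T and T^-1 are only  *)
(* used at indices k with k.+1 < n.                                            *)
Definition Lop k f : {mpoly Qqt[n]} :=
  (t_ *: 'X_k - 'X_(ordS k)) * divdiff k (ordS k) f.

Definition Top k f : {mpoly Qqt[n]} := t_ *: f - Lop k f.

Definition Tinv k f : {mpoly Qqt[n]} := t_^-1 *: f - t_^-1 *: Lop k f.

Definition omega f : {mpoly Qqt[n]} :=
  f \mPo [tuple (if val i == 0%N then q_ else 1) *: 'X_(ord_pred i) | i < n].

(* foldr applies the operator with the rightmost index first. *)
Definition Yop i f : {mpoly Qqt[n]} :=
  t_ ^- i *:
    foldr Tinv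
      (omega (foldr Top f [seq k : 'I_n <- enum 'I_n | (k < i)%N]))
      [seq k : 'I_n <- enum 'I_n | (i <= k)%N && (k.+1 < n)%N].

Definition is_nsMacdonald (eta : 'X_{1..n}) (E : {mpoly Qqt[n]}) : Prop :=
  [/\ forall zeta : 'X_{1..n}, E@_zeta != 0 -> comp_le zeta eta,
      E@_eta = 1
    & forall i : 'I_n, Yop i E = eigval eta i *: E].

End Operators.

(* c is the value at q = 1 of the rational function f, which has no pole there *)
Definition coef_at_q1 (f : Qqt) (c : Qt) : Prop :=
  exists a b : {poly {poly rat}},
    [/\ b.[1] != 0, f = a%:F / b%:F & c = a.[1]%:F / b.[1]%:F].

Definition at_q1 (n : nat) (E : {mpoly Qqt[n]}) (P : {mpoly Qt[n]}) : Prop :=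
  forall m : 'X_{1..n}, coef_at_q1 E@_m P@_m.

Definition perm_frac (n : nat) (s : 'S_n) (f : {fraction {mpoly Qt[n]}}) :
    {fraction {mpoly Qt[n]}} :=
  (msym s \n_(generic_quotient.repr f))%:F / (msym s \d_(generic_quotient.repr f))%:F.

Definition symmetric_frac (n : nat) (f : {fraction {mpoly Qt[n]}}) : Prop :=
  forall s : 'S_n, perm_frac s f = f.

(* Main.v *)
Require Import Defs.
From mathcomp Require Import all_boot all_order all_fingroup all_algebra.
From mathcomp Require Import mpoly.
From mathcomp Require Import ring zify.

Set Implicit Arguments.
Unset Strict Implicit.
Unset Printing Implicit Defensive.

Import GRing.Theory.
Local Open Scope ring_scope.

(** At [q = 1] the operators [Y_i] commute with multiplication by symmetric
    functions, and the joint eigenvalue of [E_eta] degenerates to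
    [(t^-k_i)_i], where [i |-> k_i] is the permutation ranking the positions by
    the pairs [(eta_j, j)]. The compositions [inc(lam, phi)] and [mu] have the
    same ranking. Over the field of rational functions the orbit vectors
    [(s f)_{s in S_n}] span a space of dimension [n!] on which the [Y_i] act
    linearly, and all [n!] rankings occur; hence every joint eigenspace is a
    line, and [s(P) / s(Q)] does not depend on [s] when [P] and [Q] share their
    ranking.

    Regularity at [q = 1] follows from a recursive construction of [E_eta] out
    of [1]: the raising operator [f |-> x_1 (omega^-1 f)], and intertwiners
    [T_i + c] that move the first nonzero part of [eta] to the right across
    zeros. The denominators of the [c] specialise to differences of distinct
    powers of [t], and the coefficient of [x^eta] stays [1]. The constructed
    polynomials are the given ones because their joint eigenvalues are distinct
    for generic [q], so that they form a basis of the polynomials of bounded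
    degree. *)

(** * Joint eigenspaces *)

Section JointEigenvectors.
Variables (F : fieldType) (V : lmodType F) (I : Type) (S J : finType).
Variables (Y : I -> V -> V) (y : S -> I -> F) (e : S -> V).
Hypothesis Ylin : forall i a u v, Y i (a *: u + v) = a *: Y i u + Y i v.
Hypothesis Ye : forall i s, Y i (e s) = y s i *: e s.
Hypothesis e_neq0 : forall s, e s != 0.
Hypothesis y_inj : forall s s', (forall i, y s i = y s' i) -> s = s'.

Lemma eigen_op0 i : Y i 0 = 0.
Proof. by have := Ylin i (-1) 0 0; rewrite scaler0 addr0 scaleN1r addNr. Qed.

Lemma eigen_sum i (a : S -> F) (A : {set S}) :
  Y i (\sum_(s in A) a s *: e s) = \sum_(s in A) (a s * y s i) *: e s.
Proof.
elim/big_rec2: _ => [|s u v _ <-]; first exact: eigen_op0.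
by rewrite Ylin Ye scalerA.
Qed.

(** Induction on the size of [A]: applying [Y i - y s i] to a relation removes the term of [s], so
    the shorter relation gives [a r * (y r i - y s i) = 0] for every [i]. Since [r] and [s] differ
    in some eigenvalue, [a r = 0], and then the term of [s] is alone. *)
Lemma joint_eigen_free (A : {set S}) (a : S -> F) :
  \sum_(s in A) a s *: e s = 0 -> forall s, s \in A -> a s = 0.
Proof.
elim: {A}#|A| {-2}A (erefl #|A|) a => [|k IH] A cA a sum0 s sA.
  by move: sA; rewrite (cards0_eq cA) inE.
have cAs : #|A :\ s| = k by have := cardsD1 s A; rewrite sA cA add1n => -[].
have kill i : \sum_(r in A :\ s) (a r * (y r i - y s i)) *: e r = 0.
  have Ysum : Y i (\sum_(r in A) a r *: e r) = 0.
    by rewrite sum0 eigen_op0.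
  have : \sum_(r in A) (a r * (y r i - y s i)) *: e r = 0.
    transitivity (Y i (\sum_(r in A) a r *: e r)
                  - y s i *: \sum_(r in A) a r *: e r).
      rewrite eigen_sum scaler_sumr -sumrB; apply: eq_bigr => r _.
      by rewrite scalerA -scalerBl; congr (_ *: _); ring.
    by rewrite Ysum sum0 scaler0 subr0.
  by rewrite (big_setD1 s sA) /= subrr mulr0 scale0r add0r.
have a0 r : r \in A :\ s -> a r = 0.
  move=> rA; apply/eqP; apply: contraT => ar0.
  have : r = s.
    apply: y_inj => i; have /eqP := IH _ cAs _ (kill i) r rA.
    by rewrite mulf_eq0 (negbTE ar0) subr_eq0 => /eqP.
  by move=> rs; move: rA; rewrite rs !inE eqxx.
move: sum0; rewrite (big_setD1 s sA) /= big1 => [|r rA].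
  by rewrite addr0 => /eqP; rewrite scaler_eq0 (negbTE (e_neq0 s)) orbF => /eqP.
by rewrite a0 // scale0r.
Qed.

Hypothesis card_JS : #|J| = #|S|.
Variables (b : J -> V) (C : S -> J -> F).
Hypothesis e_span : forall s, e s = \sum_j C s j *: b j.

(** The independent vectors [e s] are as many as the spanning vectors [b j], so they span the same
    space. Expanding [v] in them, freeness leaves only the term of [s0]. *)
Lemma joint_eigenspace_dim1 (v : V) (c : J -> F) (s0 : S) :
  v = \sum_j c j *: b j -> (forall i, Y i v = y s0 i *: v) ->
  exists k, v = k *: e s0.
Proof.
move=> v_span Yv.
pose m := #|S|; pose N : 'M[F]_m :=
  \matrix_(s, j) C (enum_val s) (enum_val (cast_ord (esym card_JS) j)).
have eN s : e (enum_val s) =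
    \sum_j N s j *: b (enum_val (cast_ord (esym card_JS) j)).
  rewrite e_span (reindex (fun j => enum_val (cast_ord (esym card_JS) j))) /=.
    by apply: eq_bigr => j _; rewrite mxE.
  apply: onW_bij; exists (fun j => cast_ord card_JS (enum_rank j)) => j.
    by rewrite enum_valK cast_ordKV.
  by rewrite cast_ordK enum_rankK.
(* A row in the left kernel of [N] is a linear relation between the [e s], hence zero. *)
have freeN : row_free N.
  apply/row_freeP; exists (invmx N); rewrite mulmxV //.
  rewrite -row_free_unit -kermx_eq0; apply/eqP/row_matrixP => k.
  rewrite row0; set u := row k _.
  have uN : u *m N = 0 by apply/sub_kermxP; exact: row_sub.
  have : \sum_(s in [set: S]) u 0 (enum_rank s) *: e s = 0.
    rewrite (reindex (@enum_val S predT)) /=; last first.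
      apply: onW_bij; exists enum_rank => s; [exact: enum_valK | exact: enum_rankK].
    under eq_bigl do rewrite inE.
    under eq_bigr do rewrite enum_valK eN scaler_sumr.
    rewrite exchange_big big1 //= => j _.
    under eq_bigr do rewrite scalerA.
    rewrite -scaler_suml; have /rowP/(_ j) := uN.
    by rewrite !mxE => ->; rewrite scale0r.
  move=> /joint_eigen_free u0; apply/rowP => s; rewrite [RHS]mxE.
  by have := u0 (enum_val s); rewrite inE enum_valK => ->.
(* The coordinates of [v] in the [e s] are its coordinates [c] in the [b j] times the inverse of
   [N]. *)
have [d dE] : exists d : S -> F, v = \sum_(s in [set: S]) d s *: e s.
  pose w : 'rV[F]_m := \row_j c (enum_val (cast_ord (esym card_JS) j)).
  have uN : N \in unitmx by rewrite -row_free_unit.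
  exists (fun s => (w *m invmx N) 0 (enum_rank s)).
  rewrite (reindex (@enum_val S predT)) /=; last first.
    apply: onW_bij; exists enum_rank => s; [exact: enum_valK | exact: enum_rankK].
  under eq_bigl do rewrite inE.
  under eq_bigr do rewrite enum_valK eN scaler_sumr.
  rewrite exchange_big /= v_span.
  rewrite (reindex (fun j => enum_val (cast_ord (esym card_JS) j))) /=; last first.
    apply: onW_bij; exists (fun j => cast_ord card_JS (enum_rank j)) => j.
      by rewrite enum_valK cast_ordKV.
    by rewrite cast_ordK enum_rankK.
  apply: eq_bigr => j _; under eq_bigr do rewrite scalerA.
  rewrite -scaler_suml; congr (_ *: _).
  have /rowP/(_ j) := mulmxKV uN w.
  by rewrite [LHS]mxE [RHS]mxE => <-.
have d0 s : s != s0 -> d s = 0.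
  move=> ss0; apply/eqP; apply: contraT => ds0.
  case/eqP: ss0; apply: y_inj => i.
  have : \sum_(r in [set: S]) (d r * (y r i - y s0 i)) *: e r = 0.
    transitivity (Y i v - y s0 i *: v); last by rewrite Yv subrr.
    rewrite dE eigen_sum scaler_sumr -sumrB; apply: eq_bigr => r _.
    by rewrite scalerA -scalerBl; congr (_ *: _); ring.
  move=> /joint_eigen_free/(_ s); rewrite inE => /(_ isT)/eqP.
  by rewrite mulf_eq0 (negbTE ds0) subr_eq0 => /eqP.
exists (d s0); rewrite dE (big_setD1 s0) ?inE //= big1 ?addr0 // => r.
by rewrite !inE => /andP[/d0-> _]; rewrite scale0r.
Qed.

End JointEigenvectors.

(** * Demazure-Lusztig operators *)

Section HeckeOperators.
Variables (K : fieldType) (n : nat) (t : K).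
Implicit Types (f g : {mpoly K[n]}) (i j k l : 'I_n) (s : 'S_n).

Lemma mpolyXB_neq0 i j : i != j -> 'X_i - 'X_j != 0 :> {mpoly K[n]}.
Proof.
move=> ij; apply/eqP => /(congr1 (mcoeff U_(i))).
rewrite mcoeffB !mcoeffX eqxx mcoeff0 eq_mnm1 eq_sym (negbTE ij) subr0.
by move/eqP; rewrite oner_eq0.
Qed.

Lemma msymXU s i : msym s 'X_i = 'X_(s i) :> {mpoly K[n]}.
Proof. by rewrite /msym mmapX mmap1U. Qed.

Lemma divdiff_unique i j f g : i != j ->
  ('X_i - 'X_j) * g = f - msym (tperm i j) f -> divdiff i j f = g.
Proof.
move=> ij; rewrite -divdiffP => H.
by apply: (mulfI (mpolyXB_neq0 ij)).
Qed.

Lemma divdiff_linear i j c f g : i != j ->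
  divdiff i j (c *: f + g) = c *: divdiff i j f + divdiff i j g.
Proof.
move=> ij; apply: divdiff_unique => //.
move: (divdiffP i j f) (divdiffP i j g).
move: ('X_i - 'X_j) (divdiff i j f) (divdiff i j g) => d a b Ha Hb.
by rewrite mulrDr -scalerAr Ha Hb msymD msymZ scalerBr addrACA opprD.
Qed.

(* The operators are sealed behind opaque proofs: unification would otherwise   *)
(* unfold them down to the representation of polynomials.                       *)
Fact demT_sig : {T : 'I_n -> 'I_n -> {mpoly K[n]} -> {mpoly K[n]} |
  forall i j f, T i j f = t *: f - (t *: 'X_i - 'X_j) * divdiff i j f}.
Proof. by exists (fun i j f => t *: f - (t *: 'X_i - 'X_j) * divdiff i j f). Qed.

Definition demT := sval demT_sig.

Lemma demT_def i j f :
  demT i j f = t *: f - (t *: 'X_i - 'X_j) * divdiff i j f.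
Proof. exact: (svalP demT_sig). Qed.

(** Written as [t^-1 (T - (t - 1))], the inverse is read off from the quadratic relation of [T];
    [demTinv_def] recovers the form with the divided difference. *)
Fact demTinv_sig : {T : 'I_n -> 'I_n -> {mpoly K[n]} -> {mpoly K[n]} |
  forall i j f, T i j f = t^-1 *: (demT i j f - (t - 1) *: f)}.
Proof. by exists (fun i j f => t^-1 *: (demT i j f - (t - 1) *: f)). Qed.

Definition demTinv := sval demTinv_sig.

Lemma demTinvE i j f : demTinv i j f = t^-1 *: (demT i j f - (t - 1) *: f).
Proof. exact: (svalP demTinv_sig). Qed.

Lemma demTinv_def i j f : demTinv i j f =
  t^-1 *: f - t^-1 *: ((t *: 'X_i - 'X_j) * divdiff i j f).
Proof.
rewrite demTinvE demT_def -scalerBr; congr (_ *: _).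
by rewrite scalerBl scale1r; ring.
Qed.

Lemma demT_linear i j c f g : i != j ->
  demT i j (c *: f + g) = c *: demT i j f + demT i j g.
Proof.
move=> ij; rewrite !demT_def divdiff_linear // scalerDr mulrDr.
by rewrite opprD addrACA scalerBr scalerAr !scalerA mulrC.
Qed.

Lemma demTD i j f g : i != j -> demT i j (f + g) = demT i j f + demT i j g.
Proof. by move=> ij; rewrite -[f]scale1r demT_linear // !scale1r. Qed.

Lemma demT0 i j : i != j -> demT i j 0 = 0.
Proof.
by move=> ij; have := demT_linear (-1) 0 0 ij; rewrite scaler0 addr0 scaleN1r addNr.
Qed.

Lemma demTZ i j c f : i != j -> demT i j (c *: f) = c *: demT i j f.
Proof. by move=> ij; rewrite -[c *: f]addr0 demT_linear // demT0 ?addr0. Qed.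

(** With the denominator cleared, the divided difference is gone: identities for [T] can be checked
    by [ring] after multiplying by the nonzero [x_i - x_j]. *)
Lemma demTE i j f : ('X_i - 'X_j) * demT i j f =
  (1 - t%:MP) * 'X_j * f + (t%:MP * 'X_i - 'X_j) * msym (tperm i j) f.
Proof.
rewrite !demT_def mulrBr mulrCA divdiffP -!mul_mpolyC; ring.
Qed.

Lemma mcoeffXM0 i f (m : 'X_{1..n}) : m i = 0%N -> ('X_i * f)@_m = 0.
Proof.
move=> mi; apply: memN_msupp_eq0; rewrite mulrC (perm_mem (msuppMX _ _)).
by apply/mapP => -[m' _ mE]; move: mi; rewrite mE mnmDE mnm1E eqxx.
Qed.

(* Setting [x_i = 0] turns [T] into [(t - 1) + s_i]. *)
Lemma mcoeff_demT0 i j f (m : 'X_{1..n}) : m i = 0%N ->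
  (demT i j f)@_m = (t - 1) * f@_m + f@_[multinom m (tperm i j k) | k < n].
Proof.
move=> mi; have L : ((t *: 'X_i - 'X_j) * divdiff i j f)@_m
                  = (('X_i - 'X_j) * divdiff i j f)@_m.
  by rewrite !mulrBl !mcoeffB -scalerAl mcoeffZ !(mcoeffXM0 _ mi) mulr0.
rewrite !demT_def mcoeffB mcoeffZ L divdiffP mcoeffB mcoeff_sym; ring.
Qed.

Hypothesis t0 : t != 0.

Lemma demTinvZ i j f : t *: demTinv i j f = demT i j f - (t - 1) *: f.
Proof. by rewrite demTinvE scalerA divff // scale1r. Qed.

Section FractionField.
Variables (L : fieldType) (iota : {rmorphism {mpoly K[n]} -> L}).
Hypothesis iota_inj : injective iota.

Local Notation x i := (iota 'X_i).
Local Notation tau := (iota t%:MP).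

Fact symv_sig : {v : 'S_n -> {mpoly K[n]} -> L |
  forall s f, v s f = iota (msym s f)}.
Proof. by exists (fun s f => iota (msym s f)). Qed.

Definition symv := sval symv_sig.

Lemma symvE s f : symv s f = iota (msym s f).
Proof. exact: (svalP symv_sig). Qed.

Lemma symv_inj f g : symv 1%g f = symv 1%g g -> f = g.
Proof. by rewrite !symvE !msym1m => /iota_inj. Qed.

Lemma symv_linear s c f g :
  symv s (c *: f + g) = iota c%:MP * symv s f + symv s g.
Proof. by rewrite !symvE msymD msymZ -mul_mpolyC rmorphD rmorphM. Qed.

Lemma symv_msym s s' f : symv s (msym s' f) = symv (s' * s)%g f.
Proof. by rewrite !symvE msymMm. Qed.

Lemma iotaXB_neq0 i j : i != j -> x i - x j != 0.
Proof.
move=> ij; rewrite -rmorphB -(rmorph0 iota) (inj_eq iota_inj).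
exact: mpolyXB_neq0.
Qed.

(** On the images of the [s f] in a field, [T] combines just two of them with explicit rational
    coefficients. The Hecke relations thereby become rational identities in which the values of
    [symv] are independent unknowns. *)
Lemma symv_demT i j s f : i != j ->
  symv s (demT i j f) = ((1 - tau) * x (s j) * symv s f
    + (tau * x (s i) - x (s j)) * symv (tperm i j * s)%g f)
    / (x (s i) - x (s j)).
Proof.
move=> ij; have xx : x (s i) - x (s j) != 0.
  by rewrite iotaXB_neq0 // (inj_eq perm_inj).
apply: (mulfI xx); rewrite mulrCA divff // mulr1 !symvE.
have msC : msym s t%:MP = t%:MP by rewrite /msym mmapC.
have := congr1 (iota \o msym s) (demTE i j f) => /=.
rewrite !(msymM, msymB, msymD, msymXU, msym1) msC -msymMm.
by rewrite !(rmorphD iota, rmorphM iota, rmorphN iota, rmorph1 iota).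
Qed.

Lemma symv_quadratic i j f : i != j ->
  symv 1%g (demT i j (demT i j f)) = symv 1%g ((t - 1) *: demT i j f + t *: f).
Proof.
move=> ij; have ji : j != i by rewrite eq_sym.
rewrite symv_linear -[t *: f]addr0 symv_linear.
rewrite [symv _ 0]symvE msym0 rmorph0 mpolyCB rmorphB mpolyC1 rmorph1.
rewrite !(symv_demT _ _ ij) !permM !perm1 tpermL tpermR mulg1 tperm2.
have := iotaXB_neq0 ij; have := iotaXB_neq0 ji.
move: (x i) (x j) tau (symv 1%g f) (symv (tperm i j) f) => xi xj c u v xx yy.
by field; rewrite xx yy.
Qed.

Lemma symv_comm i j k l f : i != j -> k != l -> i != k -> i != l -> j != k ->
  j != l ->
  symv 1%g (demT i j (demT k l f)) = symv 1%g (demT k l (demT i j f)).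
Proof.
move=> ij kl ik il jk jl; rewrite !(symv_demT _ _ ij, symv_demT _ _ kl) !permM !perm1.
have [dk dl] : tperm i j k = k /\ tperm i j l = l by rewrite !tpermD // eq_sym.
have [di dj] : tperm k l i = i /\ tperm k l j = j by rewrite !tpermD // eq_sym.
rewrite !(dk, dl, di, dj) !mulg1.
have -> : (tperm k l * tperm i j = tperm i j * tperm k l)%g.
  by apply/commgP/conjg_fixP; rewrite tpermJ dk dl.
have := iotaXB_neq0 kl; have := iotaXB_neq0 ij.
move: (x i) (x j) (x k) (x l) tau (symv 1%g f) (symv (tperm i j) f).
move: (symv (tperm k l) f) (symv _ f) => u v xi xj xk xl c w z xx yy.
by field; rewrite xx yy.
Qed.

(** Both sides expand over six unknowns, one for each permutation of [i], [j], [k], once the two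
    words for the longest permutation are identified. *)
Lemma symv_braid i j k f : i != j -> j != k -> i != k ->
  symv 1%g (demT i j (demT j k (demT i j f)))
  = symv 1%g (demT j k (demT i j (demT j k f))).
Proof.
move=> ij jk ik.
rewrite !(symv_demT _ _ ij, symv_demT _ _ jk) !permM !perm1 !(tpermL, tpermR) !mulg1.
have dij : tperm i j k = k by rewrite tpermD // eq_sym.
have djk : tperm j k i = i by rewrite tpermD // eq_sym.
rewrite !(dij, djk, tpermL, tpermR) !tperm2 !mulgA.
have -> : (tperm j k * tperm i j * tperm j k = tperm i j * tperm j k * tperm i j)%g.
  (* Both conjugates are the transposition of [i] and [k]. *)
  have : (tperm j k ^ tperm i j = tperm i j ^ tperm j k)%g.
    by rewrite !tpermJ tpermL tpermR dij djk.
  by rewrite !conjgE !tpermV !mulgA.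
have ji : j != i by rewrite eq_sym.
have kj : k != j by rewrite eq_sym.
have ki : k != i by rewrite eq_sym.
have := iotaXB_neq0 ij; have := iotaXB_neq0 jk; have := iotaXB_neq0 ik.
have := iotaXB_neq0 ji; have := iotaXB_neq0 kj; have := iotaXB_neq0 ki.
move: (x i) (x j) (x k) tau (symv 1%g f) (symv (tperm i j) f).
move: (symv (tperm j k) f) (symv (tperm i j * tperm j k)%g f).
move: (symv (tperm j k * tperm i j)%g f) (symv _ f).
move=> u1 u2 u3 u4 xi xj xk c u5 u6 e1 e2 e3 e4 e5 e6.
by field; rewrite ?e1 ?e2 ?e3 ?e4 ?e5 ?e6.
Qed.

End FractionField.

Lemma tofrac_inj : injective (@FracField.tofrac {mpoly K[n]}).
Proof. by move=> f g /eqP; rewrite tofrac_eq => /eqP. Qed.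

Lemma demT_quadratic i j f : i != j ->
  demT i j (demT i j f) = (t - 1) *: demT i j f + t *: f.
Proof. by move=> ij; apply/(symv_inj tofrac_inj)/symv_quadratic/ij/tofrac_inj. Qed.

Lemma demTK i j f : i != j -> demTinv i j (demT i j f) = f.
Proof.
move=> ij; rewrite demTinvE demT_quadratic // addrAC subrr add0r.
by rewrite scalerA mulVf // scale1r.
Qed.

Lemma demTinvK i j f : i != j -> demT i j (demTinv i j f) = f.
Proof.
move=> ij; rewrite demTinvE demTZ // demTD // -scaleNr demTZ // demT_quadratic //.
rewrite scaleNr addrAC subrr add0r.
by rewrite scalerA mulVf // scale1r.
Qed.

Lemma demT_comm i j k l f : i != j -> k != l -> i != k -> i != l -> j != k ->
  j != l -> demT i j (demT k l f) = demT k l (demT i j f).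
Proof.
by move=> *; apply/(symv_inj tofrac_inj)/symv_comm => //; apply: tofrac_inj.
Qed.

Lemma demT_braid i j k f : i != j -> j != k -> i != k ->
  demT i j (demT j k (demT i j f)) = demT j k (demT i j (demT j k f)).
Proof.
by move=> *; apply/(symv_inj tofrac_inj)/symv_braid => //; apply: tofrac_inj.
Qed.

(** A cross relation of the affine Hecke algebra. Together with [demTinv_Xr] it moves the factor
    [x_1] of the raising operator through the operators [Y_i]. *)
Lemma demT_Xl i j f : i != j -> demT i j ('X_i * f) = t *: ('X_j * demTinv i j f).
Proof.
move=> ij; apply: (mulfI (mpolyXB_neq0 ij)).
rewrite scalerAr demTinvZ mulrCA mulrBr !demTE msymM msymXU tpermL.
rewrite -mul_mpolyC mpolyCB mpolyC1; ring.
Qed.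

Lemma demTinv_Xr i j f : i != j -> t *: demTinv i j ('X_j * f) = 'X_i * demT i j f.
Proof.
move=> ij; apply: (mulfI (mpolyXB_neq0 ij)).
rewrite demTinvZ mulrBr demTE [RHS]mulrCA demTE msymM msymXU tpermR.
rewrite -mul_mpolyC mpolyCB mpolyC1; ring.
Qed.

Lemma demT_XD i j k f : i != j -> k != i -> k != j ->
  demT i j ('X_k * f) = 'X_k * demT i j f.
Proof.
move=> ij ki kj; apply: (mulfI (mpolyXB_neq0 ij)).
rewrite mulrCA !demTE msymM msymXU tpermD 1?eq_sym //; ring.
Qed.

Lemma demTinv_XD i j k f : i != j -> k != i -> k != j ->
  demTinv i j ('X_k * f) = 'X_k * demTinv i j f.
Proof.
by move=> ij ki kj; rewrite !demTinvE demT_XD // -scalerAr mulrBr -scalerAr.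
Qed.

Lemma demT1 i j : i != j -> demT i j 1 = t%:MP.
Proof.
move=> ij; apply: (mulfI (mpolyXB_neq0 ij)); rewrite demTE msym1; ring.
Qed.

End HeckeOperators.

(** * Monomial substitutions, and the operators over a general field *)

Section MonomialSubstitution.
Variables (K : fieldType) (n : nat).
Implicit Types (f g : {mpoly K[n]}) (c : 'I_n -> K) (p : 'I_n -> 'I_n).

Fact msub_sig : {u : ('I_n -> K) -> ('I_n -> 'I_n) -> {mpoly K[n]} -> {mpoly K[n]} |
  forall c p f, u c p f = f \mPo [tuple c i *: 'X_(p i) | i < n]}.
Proof. by exists (fun c p f => f \mPo [tuple c i *: 'X_(p i) | i < n]). Qed.

Definition msub := sval msub_sig.

Lemma msubE c p f : msub c p f = f \mPo [tuple c i *: 'X_(p i) | i < n].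
Proof. exact: (svalP msub_sig). Qed.

Lemma msubD c p f g : msub c p (f + g) = msub c p f + msub c p g.
Proof. by rewrite !msubE comp_mpolyD. Qed.

Lemma msubZ c p a f : msub c p (a *: f) = a *: msub c p f.
Proof. by rewrite !msubE comp_mpolyZ. Qed.

Lemma msubM c p f g : msub c p (f * g) = msub c p f * msub c p g.
Proof. by rewrite !msubE rmorphM. Qed.

Lemma msub1 c p : msub c p 1 = 1.
Proof. by rewrite !msubE comp_mpoly1. Qed.

Lemma msub0 c p : msub c p 0 = 0.
Proof. by rewrite !msubE comp_mpoly0. Qed.

Lemma msubB c p f g : msub c p (f - g) = msub c p f - msub c p g.
Proof. by rewrite !msubE comp_mpolyB. Qed.

Lemma msubXU c p i : msub c p 'X_i = c i *: 'X_(p i).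
Proof. by rewrite msubE comp_mpolyXU -tnth_nth tnth_mktuple. Qed.

(** Substitutions and permutations of variables are algebra maps, so identities between them need to
    be checked on variables only. *)
Lemma mpoly_alg_ind (P : {mpoly K[n]} -> Prop) :
  P 1 -> (forall i, P 'X_i) -> (forall f g, P f -> P g -> P (f * g)) ->
  P 0 -> (forall a f g, P f -> P g -> P (a *: f + g)) -> forall f, P f.
Proof.
move=> P1 PX PM P0 PL; elim/mpolyind => // a m f _ _ Pf.
apply: PL => //; rewrite mpolyXE_id.
elim/big_rec: _ => // k g _ Pg; apply: (PM) => //.
by elim: (m k) => [|e IH]; rewrite ?expr0 // exprS; apply: (PM).
Qed.

Lemma msub_comp c p c' p' f :
  msub c p (msub c' p' f) = msub (fun i => c' i * c (p' i)) (p \o p') f.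
Proof.
elim/mpoly_alg_ind: f => [|i|f g|| a f g].
- by rewrite !msub1.
- by rewrite !msubXU msubZ msubXU scalerA.
- by rewrite !msubM => -> ->.
- by rewrite !msub0.
- by rewrite !msubD !msubZ => -> ->.
Qed.

Lemma eq_msub c p c' p' f : c =1 c' -> p =1 p' -> msub c p f = msub c' p' f.
Proof.
move=> cc pp; elim/mpoly_alg_ind: f => [|i|f g|| a f g].
- by rewrite !msub1.
- by rewrite !msubXU cc pp.
- by rewrite !msubM => -> ->.
- by rewrite !msub0.
- by rewrite !msubD !msubZ => -> ->.
Qed.

Lemma msub_id f : msub (fun _ => 1) id f = f.
Proof.
elim/mpoly_alg_ind: f => [|i|f g|| a f g].
- by rewrite msub1.
- by rewrite msubXU scale1r.
- by rewrite msubM => -> ->.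
- by rewrite msub0.
- by rewrite msubD msubZ => -> ->.
Qed.

Lemma msub_perm (s : 'S_n) f : msub (fun _ => 1) s f = msym s f.
Proof.
elim/mpoly_alg_ind: f => [|i|f g|| a f g].
- by rewrite msub1 msym1.
- by rewrite msubXU scale1r msymXU.
- by rewrite msubM msymM => -> ->.
- by rewrite msub0 msym0.
- by rewrite msubD msubZ msymD msymZ => -> ->.
Qed.

Lemma msub_msym c p (s s' : 'S_n) f :
  (forall i, c (s i) = c i) -> (forall i, p (s i) = s' (p i)) ->
  msub c p (msym s f) = msym s' (msub c p f).
Proof.
move=> cs ps; rewrite -!msub_perm !msub_comp; apply: eq_msub => i /=.
  by rewrite mul1r mulr1 cs.
exact: ps.
Qed.

(** When [x_i] and [x_j] are scaled alike, [x_i - x_j] only acquires the factor [c i], and the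
    exchange of the two variables is carried along. The image of [demTE] is then [c i] times the
    equation that characterises [T] at the new positions. *)
Lemma msub_demT t c p i j f : i != j -> injective p -> c i = c j -> c i != 0 ->
  msub c p (demT t i j f) = demT t (p i) (p j) (msub c p f).
Proof.
move=> ij p_inj cij ci0.
have pij : p i != p j by rewrite (inj_eq p_inj).
have /(congr1 (msub c p)) := demTE t i j f.
rewrite !(msubM, msubB, msubD, msubXU, msub1) -cij.
have msC : msub c p t%:MP = t%:MP by rewrite msubE comp_mpolyC.
rewrite msC (@msub_msym _ _ _ (tperm (p i) (p j))); first last.
- by move=> k; rewrite inj_tperm.
- by move=> k; case: tpermP => [->|->|].
rewrite -!mul_mpolyC => H.
have C0 : (c i)%:MP != 0 :> {mpoly K[n]} by rewrite mpolyC_eq0.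
apply: (mulfI (mpolyXB_neq0 K pij)); apply: (mulfI C0).
rewrite demTE !mulrA mulrBr H; ring.
Qed.

End MonomialSubstitution.

Section GenericOperators.
Variables (K : fieldType) (n : nat) (q t : K).
Implicit Types (f : {mpoly K[n]}) (i k : 'I_n).

(* The operators of the statement over an arbitrary field: at [K = Q(q,t)] they  *)
(* are the given ones, at [K = Q(t)] and [q = 1] their specialisations.           *)
Definition omegaK f := msub (fun i => if val i == 0%N then q else 1) (@ord_pred n) f.

Definition YopK i f : {mpoly K[n]} :=
  t ^- i *:
    foldr (fun k => demTinv t k (ordS k))
      (omegaK (foldr (fun k => demT t k (ordS k)) f
                 [seq k : 'I_n <- enum 'I_n | (k < i)%N]))
      [seq k : 'I_n <- enum 'I_n | (i <= k)%N && (k.+1 < n)%N].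

End GenericOperators.

Lemma YopKE n (i : 'I_n) f : Yop i f = YopK q_ t_ i f.
Proof.
rewrite /Yop /YopK /omegaK msubE /omega.
have eT (s : seq 'I_n) g : foldr (@Top n) g s = foldr (fun k => demT t_ k (ordS k)) g s.
  by elim: s => //= k s ->; rewrite demT_def.
have eTi (s : seq 'I_n) g :
    foldr (@Tinv n) g s = foldr (fun k => demTinv t_ k (ordS k)) g s.
  by elim: s => //= k s ->; rewrite demTinv_def.
by rewrite eT eTi.
Qed.

(** * Positions as natural numbers *)

Section Indices.
Variable N : nat.
Local Notation idx k := (inord k : 'I_N.+1).
Implicit Types (i j k : nat).

Lemma idx_neq i j : (i <= N)%N -> (j <= N)%N -> i != j -> idx i != idx j.
Proof.
move=> iN jN; apply: contraNneq => /(congr1 val).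
by rewrite /= !inordK // => ->.
Qed.

Lemma idx_neqS k : (k < N)%N -> idx k != idx k.+1.
Proof. by move=> kN; apply: idx_neq; lia. Qed.

Lemma ordS_idx k : (k < N)%N -> ordS (idx k) = idx k.+1.
Proof.
move=> kN; apply: val_inj; rewrite /= inordK; last by lia.
by rewrite [RHS]inordK ?modn_small.
Qed.

Lemma ord_pred_idx k : (k < N)%N -> ord_pred (idx k.+1) = idx k.
Proof. by move=> kN; rewrite -ordS_idx // ordSK. Qed.

Lemma ordS_eq0 (i : 'I_N.+1) : (val (ordS i) == 0%N) = (val i == N).
Proof.
case: i => i /= iN; have [->|iN'] := eqVneq i N; first by rewrite modnn.
by rewrite modn_small //; lia.
Qed.

End Indices.

(** * Ranking of the positions *)

Section Rank.
Variable n : nat.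
Implicit Types (eta : 'X_{1..n}) (i j : 'I_n).

(** It is [j] that wins here: [(eta_j, j)] is lexicographically larger than [(eta_i, i)]. Hence
    [rk eta i] counts the positions above [i], and is the exponent of [t^-1] in the eigenvalue. *)
Definition beats eta i j :=
  ((i < j)%N && (eta i <= eta j)%N) || ((j < i)%N && (eta i < eta j)%N).

Definition rk eta i := #|[set j | beats eta i j]|.

Lemma rkE eta i :
  rk eta i = (#|[set j : 'I_n | (i < j)%N && (eta i <= eta j)%N]|
              + #|[set j : 'I_n | (j < i)%N && (eta i < eta j)%N]|)%N.
Proof.
rewrite -cardsUI [X in (_ + #|pred_of_set X|)%N](_ : _ = set0) ?cards0 ?addn0.
  by apply: eq_card => j; rewrite !inE.
by apply/setP => j; rewrite !inE; apply/negP; lia.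
Qed.

Lemma rk_lt eta i j : beats eta i j -> (rk eta j < rk eta i)%N.
Proof.
move=> bij; apply: proper_card; apply/properP; split.
  apply/subsetP => k; rewrite !inE; move: bij; rewrite /beats.
  have [<-|] := eqVneq i k; first by lia.
  by rewrite -val_eqE /=; lia.
by exists j; rewrite !inE // /beats; lia.
Qed.

(** Of two distinct positions one beats the other, and the winner has the smaller rank. *)
Lemma rk_inj eta : injective (rk eta).
Proof.
move=> i j rij; apply: val_inj => /=; apply/eqP; apply: contraT => ij.
have [b|b] : beats eta i j \/ beats eta j i by rewrite /beats; lia.
  by have := rk_lt b; rewrite rij ltnn.
by have := rk_lt b; rewrite rij ltnn.
Qed.

Lemma rk_ltn eta i : (rk eta i < n)%N.
Proof.
rewrite -[X in (_ < X)%N]card_ord -cardsT; apply: proper_card; apply/properP.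
by split; [apply/subsetP => k; rewrite inE | exists i; rewrite ?inE // /beats; lia].
Qed.

Lemma eq_rk eta eta' i (p : 'I_n -> 'I_n) : injective p ->
  (forall j, beats eta (p i) (p j) = beats eta' i j) -> rk eta (p i) = rk eta' i.
Proof.
move=> p_inj E; rewrite /rk -[RHS](card_imset _ p_inj); apply: eq_card => j.
rewrite inE; apply/idP/imsetP => [bj|[k kb ->]]; last by rewrite E; rewrite inE in kb.
have [g pg gp] := injF_bij p_inj.
by exists (g j); rewrite ?gp // inE -E gp.
Qed.

Definition eigK (K : fieldType) (q t : K) eta i := q ^+ eta i * t ^- rk eta i.

Definition Yeigen (K : fieldType) (q t : K) eta (f : {mpoly K[n]}) :=
  forall i, YopK q t i f = eigK q t eta i *: f.

End Rank.


(** * Cherednik operators, intertwiners and the raising operator *)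

Section CherednikOperators.
Variables (K : fieldType) (N : nat) (q t : K).
Hypotheses (q0 : q != 0) (t0 : t != 0).
Local Notation poly := {mpoly K[N.+1]}.
Local Notation idx k := (inord k : 'I_N.+1).
Implicit Types (f g : poly) (i j k : nat).

Definition Tk k f := demT t (idx k) (idx k.+1) f.
Definition Tik k f := demTinv t (idx k) (idx k.+1) f.
Definition Bk i f := foldr Tik f (iota i (N - i)).
Definition Ak i f := foldr Tk f (iota 0 i).
Definition Yk i f := t ^- i *: Bk i (omegaK q (Ak i f)).

(** Turns the filtered lists of ordinals into intervals of natural numbers, which makes recursion on
    [i] possible. *)
Lemma YopK_Yk (i : 'I_N.+1) f : YopK q t i f = Yk i f.
Proof.
have iN : (i <= N)%N by rewrite -ltnS.
have E (a b : nat) : (b <= N.+1)%N ->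
    [seq k <- enum 'I_N.+1 | (a <= val k < b)%N]
    = [seq idx k | k <- iota a (b - a)].
  move=> bN; apply: (inj_map val_inj); rewrite -map_comp.
  have -> : [seq (val \o (fun k => idx k)) k | k <- iota a (b - a)] = iota a (b - a).
    apply: map_id_in => k; rewrite mem_iota => /andP[ak kb].
    by rewrite /= inordK //; lia.
  rewrite -(@filter_map _ _ val (fun k => a <= k < b)%N) val_enum_ord.
  apply: (irr_sorted_eq ltn_trans ltnn);
    rewrite ?(sorted_filter ltn_trans) ?iota_ltn_sorted //.
  by move=> k; rewrite mem_filter !mem_iota; lia.
rewrite /YopK /Yk /Ak /Bk; congr (_ *: _).
have -> : [seq k : 'I_N.+1 <- enum 'I_N.+1 | (k < i)%N] = [seq idx k | k <- iota 0 i].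
  by rewrite -[in RHS](subn0 i) -E //; lia.
have -> : [seq k : 'I_N.+1 <- enum 'I_N.+1 | (i <= k)%N && (k.+1 < N.+1)%N]
          = [seq idx k | k <- iota i (N - i)].
  by rewrite -E //.
rewrite !foldr_map.
have eT (s : seq nat) g : all (fun k => k < N)%N s ->
    foldr (fun k z => demT t (idx k) (ordS (idx k)) z) g s = foldr Tk g s.
  by elim: s => //= k s IH /andP[kN /IH ->]; rewrite ordS_idx.
have eTi (s : seq nat) g : all (fun k => k < N)%N s ->
    foldr (fun k z => demTinv t (idx k) (ordS (idx k)) z) g s = foldr Tik g s.
  by elim: s => //= k s IH /andP[kN /IH ->]; rewrite ordS_idx.
rewrite eT ?eTi //; apply/allP => k; rewrite mem_iota; lia.
Qed.

Lemma Tk_linear k a f g : (k < N)%N -> Tk k (a *: f + g) = a *: Tk k f + Tk k g.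
Proof. by move=> kN; rewrite /Tk demT_linear // idx_neqS. Qed.

Lemma TkZ k a f : (k < N)%N -> Tk k (a *: f) = a *: Tk k f.
Proof. by move=> kN; rewrite /Tk demTZ // idx_neqS. Qed.

Lemma TkD k f g : (k < N)%N -> Tk k (f + g) = Tk k f + Tk k g.
Proof. by move=> kN; rewrite /Tk demTD // idx_neqS. Qed.

Lemma TikE k f : Tik k f = t^-1 *: (Tk k f - (t - 1) *: f).
Proof. by rewrite /Tik demTinvE. Qed.

Lemma Tik_linear k a f g : (k < N)%N -> Tik k (a *: f + g) = a *: Tik k f + Tik k g.
Proof.
by move=> kN; rewrite !TikE Tk_linear // -!mul_mpolyC; ring.
Qed.

Lemma TikZ k a f : (k < N)%N -> Tik k (a *: f) = a *: Tik k f.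
Proof.
move=> kN; rewrite !TikE TkZ // scalerA [(t - 1) * a]mulrC -scalerA -scalerBr.
by rewrite !scalerA mulrC.
Qed.

Lemma TkK k f : (k < N)%N -> Tik k (Tk k f) = f.
Proof. by move=> kN; rewrite /Tk /Tik demTK // idx_neqS. Qed.

Lemma TikK k f : (k < N)%N -> Tk k (Tik k f) = f.
Proof. by move=> kN; rewrite /Tk /Tik demTinvK // idx_neqS. Qed.

Lemma Tk_comm k l f : (k.+1 < l < N)%N -> Tk k (Tk l f) = Tk l (Tk k f).
Proof. by move=> kl; rewrite /Tk demT_comm // idx_neq //; lia. Qed.

Lemma Tk_Tik_comm k l f : (k.+1 < l < N)%N -> Tk k (Tik l f) = Tik l (Tk k f).
Proof.
move=> kl; have kN : (k < N)%N by lia.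
by rewrite !TikE TkZ // TkD // -scaleNr TkZ // Tk_comm // scaleNr.
Qed.

Lemma Tk_Tik_comm_gt k l f : (l.+1 < k < N)%N -> Tk k (Tik l f) = Tik l (Tk k f).
Proof.
move=> kl; have kN : (k < N)%N by lia.
by rewrite !TikE TkZ // TkD // -scaleNr TkZ // -Tk_comm // scaleNr.
Qed.

Lemma Tk_braid k f : (k.+1 < N)%N ->
  Tk k (Tk k.+1 (Tk k f)) = Tk k.+1 (Tk k (Tk k.+1 f)).
Proof. by move=> kN; rewrite /Tk demT_braid // idx_neq //; lia. Qed.

Lemma Tk_Tik_braid k f : (k.+1 < N)%N ->
  Tk k.+1 (Tik k (Tik k.+1 f)) = Tik k (Tik k.+1 (Tk k f)).
Proof.
move=> kN; have kN' : (k < N)%N by lia.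
(* In terms of [g] the claim is the braid relation with [T_k^-1 T_(k+1)^-1] applied to it. *)
pose g := Tik k (Tik k.+1 f); have fE : f = Tk k.+1 (Tk k g) by rewrite /g !TikK.
by rewrite -/g [in RHS]fE Tk_braid // !TkK.
Qed.

Lemma Tk_Bk k i f : (k.+1 < i)%N -> Tk k (Bk i f) = Bk i (Tk k f).
Proof.
move=> ki; rewrite /Bk; have : all (fun l => k.+1 < l < N)%N (iota i (N - i)).
  by apply/allP => l; rewrite mem_iota; lia.
by elim: (iota _ _) => //= l s IH /andP[kl /IH <-]; rewrite Tk_Tik_comm.
Qed.

Lemma BkS i f : (i < N)%N -> Bk i f = Tik i (Bk i.+1 f).
Proof. by move=> iN; rewrite /Bk -[(N - i)%N]prednK ?subn_gt0 //= subnS. Qed.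

Lemma BkN f : Bk N f = f.
Proof. by rewrite /Bk subnn. Qed.

Lemma AkS i f : Ak i.+1 f = Ak i (Tk i f).
Proof. by rewrite /Ak -(addn1 i) iotaD foldr_cat. Qed.

(** [T_(k+1)] commutes with the factors before [T_k^-1], becomes [T_k] in passing
    [T_k^-1 T_(k+1)^-1], and commutes with all later factors. *)
Lemma Tk_Bk_slide i k f : (i <= k)%N -> (k.+1 < N)%N ->
  Tk k.+1 (Bk i f) = Bk i (Tk k f).
Proof.
move=> ik kN; rewrite -(subKn ik); move: (k - i)%N (leq_subr i k) => d.
elim: d => [|d IH] dk.
  rewrite subn0 BkS ?(BkS (i := k.+1)) //; last by lia.
  by rewrite Tk_Tik_braid // Tk_Bk // -BkS // -BkS //; lia.
rewrite BkS; last by lia.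
have dkS : (k - d.+1).+1 = (k - d)%N by lia.
rewrite dkS Tk_Tik_comm_gt; last by lia.
rewrite IH; last by lia.
by rewrite -dkS -BkS //; lia.
Qed.

(* [omega^-1] *)
Definition Wk f :=
  msub (fun i : 'I_N.+1 => if val i == N then q^-1 else 1) (@ordS N.+1) f.
Definition Phik f := 'X_(idx 0) * Wk f.

Local Notation om := (omegaK q).

Lemma omegaKZ a f : om (a *: f) = a *: om f. Proof. exact: msubZ. Qed.
Lemma WkZ a f : Wk (a *: f) = a *: Wk f. Proof. exact: msubZ. Qed.

Lemma WkK f : om (Wk f) = f.
Proof.
rewrite /om /Wk msub_comp -[RHS]msub_id; apply: eq_msub => i /=.
  by rewrite ordS_eq0; case: eqP; rewrite ?mulVf ?mulr1.
exact: ordSK.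
Qed.

Lemma omegaKK f : Wk (om f) = f.
Proof.
rewrite /om /Wk msub_comp -[RHS]msub_id; apply: eq_msub => i /=.
  by rewrite -{1}[i]ord_predK ordS_eq0; case: eqP; rewrite ?mulfV ?mulr1.
exact: ord_predK.
Qed.

Lemma omegaK_Tk k f : (k.+1 < N)%N -> om (Tk k.+1 f) = Tk k (om f).
Proof.
move=> kN; have kN' : (k < N)%N by exact: ltnW.
have e1 : val (idx k.+1) = k.+1 by rewrite /= inordK.
have e2 : val (idx k.+2) = k.+2 by rewrite /= inordK.
rewrite /Tk /omegaK msub_demT ?e1 ?e2 ?oner_eq0 ?idx_neqS //.
  by rewrite !ord_pred_idx.
exact: ord_pred_inj.
Qed.

Lemma Wk_Tk k f : (k.+1 < N)%N -> Wk (Tk k f) = Tk k.+1 (Wk f).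
Proof. by move=> kN; rewrite -{1}[f]WkK -omegaK_Tk // omegaKK. Qed.

Lemma Wk_Tik k f : (k.+1 < N)%N -> Wk (Tik k f) = Tik k.+1 (Wk f).
Proof. by move=> kN; rewrite !TikE WkZ /Wk msubB msubZ -!/(Wk _) Wk_Tk. Qed.

(** A single [omega] scales the first variable by [q] but not the second, so it does not carry [T_0]
    along. After two of them both variables have the factor [q] and [msub_demT] applies. *)
Lemma omegaK2_Tk f : (0 < N)%N -> om (om (Tk 0 f)) = Tk N.-1 (om (om f)).
Proof.
move=> N0.
have v0 : (val (idx 0) == 0%N) = true by rewrite /= inordK.
have v1 : (val (idx 1) == 0%N) = false by rewrite /= inordK.
have E0 : ord_pred (idx 0) = idx N.
  by apply: val_inj; rewrite /= !inordK // modn_small.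
have vp : (val (ord_pred (idx 0)) == 0%N) = false.
  by rewrite E0 /= inordK // eqn0Ngt N0.
rewrite /omegaK !msub_comp /Tk msub_demT ?idx_neqS //.
- have EN : ord_pred (idx N) = idx N.-1.
    by have := @ord_pred_idx N N.-1; rewrite prednK // => -> //; rewrite prednK.
  by rewrite /= E0 ord_pred_idx // E0 EN prednK.
- exact: inj_comp (@ord_pred_inj _) (@ord_pred_inj _).
- by rewrite ord_pred_idx // v0 v1 vp mulr1 mul1r.
- by rewrite v0 vp mulr1.
Qed.

Lemma omegaK_Tik_Wk f : (0 < N)%N -> om (Tik 0 (Wk f)) = Wk (Tik N.-1 (om f)).
Proof.
move=> N0; have E : om (Tk 0 (Wk f)) = Wk (Tk N.-1 (om f)).
  by rewrite -[LHS]omegaKK omegaK2_Tk // WkK.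
rewrite !TikE omegaKZ WkZ /om /Wk !msubB !msubZ -!/(Wk _) -!/(om _).
by rewrite E WkK omegaKK.
Qed.

(** The recursion through which statements on all [Y_i] are reduced to [Y_0]. *)
Lemma YkS i f : (i < N)%N -> Yk i.+1 f = t^-1 *: Tk i (Yk i (Tk i f)).
Proof.
move=> iN; rewrite /Yk (BkS _ iN) TkZ // TikK // AkS scalerA exprS invfM.
by rewrite mulrC.
Qed.

(** Sliding through the product of inverses lowers the index by one, and passing [omega] raises it
    again. *)
Lemma Yk0_comm k f : (k.+1 < N)%N -> Tk k.+1 (Yk 0 f) = Yk 0 (Tk k.+1 f).
Proof.
move=> kN; rewrite /Yk TkZ // Tk_Bk_slide //.
by rewrite -omegaK_Tk.
Qed.

Lemma Yk_comm k i f : (k < N)%N -> (i <= N)%N -> k != i -> k.+1 != i ->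
  Tk k (Yk i f) = Yk i (Tk k f).
Proof.
elim/ltn_ind: i k f => -[|i] IH k f kN iN ki kSi.
  by case: k kN ki {kSi} => // k kN _; rewrite Yk0_comm.
rewrite !YkS // TkZ //; congr (_ *: _).
have [kS|kS] := eqVneq k.+1 i; last first.
  have comm g : Tk k (Tk i g) = Tk i (Tk k g).
    by case: (ltnP k i) => ?; [rewrite Tk_comm | rewrite [RHS]Tk_comm] => //; lia.
  by rewrite comm IH ?comm //; lia.
(* Here [Y_(k+2) = t^-2 T_(k+1) T_k Y_k T_k T_(k+1)]. A braid relation on each side lets [T_k]
   cross; in the middle it has become [T_(k+1)], which commutes with [Y_k] by induction. *)
have kSN : (k.+1 < N)%N by rewrite kS.
rewrite -kS !(YkS _ kN) !(TkZ _ _ kSN) (TkZ _ _ kN); congr (_ *: _).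
have IHk g : Tk k.+1 (Yk k g) = Yk k (Tk k.+1 g).
  by rewrite IH //; lia.
by rewrite Tk_braid // IHk -Tk_braid.
Qed.

Lemma Tk_Phik k f : (k.+1 < N)%N -> Tk k.+1 (Phik f) = Phik (Tk k f).
Proof.
by move=> kN; rewrite /Phik Wk_Tk // /Tk demT_XD // idx_neq //; lia.
Qed.

Lemma Bk_X0 i f : (0 < i)%N -> Bk i ('X_(idx 0) * f) = 'X_(idx 0) * Bk i f.
Proof.
move=> i0; rewrite /Bk; have : all (fun l => 0 < l < N)%N (iota i (N - i)).
  by apply/allP => l; rewrite mem_iota; lia.
elim: (iota _ _) => //= l s IH /andP[kl /IH ->].
by rewrite /Tik demTinv_XD // idx_neq //; lia.
Qed.

Lemma Wk_Bk0 f : (0 < N)%N -> Wk (Bk 0 f) = Bk 1 (Wk (Tik N.-1 f)).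
Proof.
move=> N0; have iotaN : iota 0 N = iota 0 N.-1 ++ [:: N.-1].
  by rewrite -[X in _ ++ [:: X]]add0n -(iotaD 0 N.-1 1) addn1 prednK.
rewrite /Bk subn0 subn1 iotaN foldr_cat /=; move: (Tik _ f) => g.
have : all (fun l => l.+1 < N)%N (iota 0 N.-1).
  by apply/allP => l; rewrite mem_iota; lia.
rewrite -[in RHS](addn0 1%N) iotaDl.
elim: (iota _ _) => //= l s IH /andP[kl /IH <-].
by rewrite Wk_Tik.
Qed.

(** [T_0 x_0 = t x_1 T_0^-1], [omega] takes [x_1] to [x_0], and [x_0] commutes with the inverses of
    index at least 1. The remaining [omega T_0^-1 omega^-1] supplies the last factor of the product
    in [Y_0]. *)
Lemma Yk1_Phik f : (0 < N)%N -> Yk 1 (Phik f) = Phik (Yk 0 f).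
Proof.
move=> N0; rewrite /Yk expr0 invr1 scale1r /Phik /Ak /=.
rewrite Wk_Bk0 // -omegaK_Tik_Wk // /Tk demT_Xl ?idx_neqS //.
have v1 : (val (idx 1) == 0%N) = false by rewrite /= inordK.
rewrite omegaKZ /omegaK msubM msubXU v1 ord_pred_idx // scale1r.
have Bk1Z a g : Bk 1 (a *: g) = a *: Bk 1 g.
  rewrite /Bk; have : all (fun l => l < N)%N (iota 1 (N - 1)).
    by apply/allP => l; rewrite mem_iota; lia.
  by elim: (iota _ _) => //= l s IH /andP[kl /IH ->]; rewrite TikZ.
by rewrite Bk1Z scalerA expr1 mulVf // scale1r Bk_X0.
Qed.

Lemma YkS_Phik i f : (i < N)%N -> Yk i.+1 (Phik f) = Phik (Yk i f).
Proof.
elim: i f => [|i IH] f iN; first exact: Yk1_Phik.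
rewrite YkS // Tk_Phik // IH; last by lia.
rewrite Tk_Phik // [in RHS]YkS; last by lia.
by rewrite /Phik WkZ scalerAr.
Qed.

(** Each [T_k^-1] met by the variable lowers its index by one and turns into [t^-1 T_k]. In
    [Yk0_Phik] this converts the inverses of [Y_0] into the product of [Y_N], while [q] comes from
    [omega x_0 = q x_N]. *)
Lemma Bk_XN i f : (i <= N)%N ->
  Bk i ('X_(idx N) * f) = t ^- (N - i) *: ('X_(idx i) * foldr Tk f (iota i (N - i))).
Proof.
move=> iN; rewrite -(subKn iN); move: (N - i)%N (leq_subr i N) => d.
elim: d => [|d IH] dN.
  by rewrite subn0 BkN subnn expr0 invr1 scale1r.
have dS : (N - d.+1).+1 = (N - d)%N by lia.
have dN' : (N - d.+1 < N)%N by lia.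
rewrite BkS // dS IH; last by lia.
rewrite TikZ // !subKn //; last by lia.
rewrite /= dS; move: (foldr _ _ _) => g.
have -> : Tik (N - d.+1) ('X_(idx (N - d)) * g)
          = t^-1 *: ('X_(idx (N - d.+1)) * Tk (N - d.+1) g).
  by rewrite /Tk -dS -demTinv_Xr ?idx_neqS // scalerA mulVf // scale1r.
by rewrite scalerA exprS invfM mulrC.
Qed.

Lemma Yk0_Phik f : Yk 0 (Phik f) = q *: Phik (Yk N f).
Proof.
rewrite /Yk expr0 invr1 scale1r BkN /Phik /Ak /= /omegaK msubM msubXU.
have -> : ord_pred (idx 0) = idx N.
  by apply: val_inj; rewrite /= !inordK // modn_small.
have -> : (val (idx 0) == 0%N) = true by rewrite /= inordK.
rewrite -/(omegaK q _) WkK -scalerAl.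
have Bk0Z a g : Bk 0 (a *: g) = a *: Bk 0 g.
  rewrite /Bk; have : all (fun l => l < N)%N (iota 0 (N - 0)).
    by apply/allP => l; rewrite mem_iota; lia.
  by elim: (iota _ _) => //= l s IH /andP[kl /IH ->]; rewrite TikZ.
rewrite Bk0Z Bk_XN // WkZ -/(omegaK q _) omegaKK subn0.
by rewrite scalerAr.
Qed.

Local Notation T := Tk.
Local Notation Y := Yk.
Implicit Type eta : 'X_{1..N.+1}.

Lemma Yk_linear i a f g : (i <= N)%N -> Y i (a *: f + g) = a *: Y i f + Y i g.
Proof.
move=> iN; rewrite /Yk.
have A b u v : Ak i (b *: u + v) = b *: Ak i u + Ak i v.
  rewrite /Ak; have : all (fun l => l < N)%N (iota 0 i).
    by apply/allP => l; rewrite mem_iota; lia.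
  by elim: (iota _ _) => //= l s IH /andP[kl /IH ->]; rewrite Tk_linear.
have B b u v : Bk i (b *: u + v) = b *: Bk i u + Bk i v.
  rewrite /Bk; have : all (fun l => l < N)%N (iota i (N - i)).
    by apply/allP => l; rewrite mem_iota; lia.
  by elim: (iota _ _) => //= l s IH /andP[kl /IH ->]; rewrite Tik_linear.
rewrite A /omegaK msubD msubZ B scalerDr !scalerA.
by rewrite mulrC.
Qed.

Lemma YkD i f g : (i <= N)%N -> Y i (f + g) = Y i f + Y i g.
Proof. by move=> iN; rewrite -[f]scale1r Yk_linear // !scale1r. Qed.

Lemma YkZ i a f : (i <= N)%N -> Y i (a *: f) = a *: Y i f.
Proof.
move=> iN; have Y0 : Y i 0 = 0.
  by have := Yk_linear (-1) 0 0 iN; rewrite scaler0 addr0 scaleN1r addNr.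
by rewrite -[a *: f]addr0 Yk_linear // Y0 addr0.
Qed.

(** On the span of [f] and [T_i f] the operators [Y_i] and [Y_(i+1)] are triangular; the equation
    for [c] singles out the eigenvector for which their eigenvalues are exchanged. *)
Lemma Yk_intertwine i (y : nat -> K) c f : (i < N)%N ->
  (forall j, (j <= N)%N -> Y j f = y j *: f) ->
  c * (y i - y i.+1) = (t - 1) * y i.+1 ->
  [/\ Y i (T i f + c *: f) = y i.+1 *: (T i f + c *: f),
      Y i.+1 (T i f + c *: f) = y i *: (T i f + c *: f)
    & forall j, (j <= N)%N -> j != i -> j != i.+1 ->
      Y j (T i f + c *: f) = y j *: (T i f + c *: f)].
Proof.
move=> iN Yf cE; have iN' : (i <= N)%N by exact: ltnW.
have TT g : T i (T i g) = (t - 1) *: T i g + t *: g.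
  by rewrite /Tk demT_quadratic // idx_neqS.
(* The recursion at the eigenvector reads [T_i Y_i T_i f = t y_(i+1) f]; now [T_i] is inverted. *)
have YT : Y i (T i f) = y i.+1 *: (T i f - (t - 1) *: f).
  have := Yf _ iN; rewrite YkS // => /(congr1 (fun u => t *: u)).
  rewrite !scalerA divff // scale1r => /(congr1 (Tik i)).
  rewrite TkK // TikZ // TikE => ->; rewrite !scalerA mulrAC divff //.
  by rewrite mul1r.
have TiT : T i (T i f - (t - 1) *: f) = t *: f.
  by rewrite TkD // -scaleNr TkZ // TT scaleNr addrAC subrr add0r.
have YST : Y i.+1 (T i f) = y i *: T i f + ((t - 1) * y i.+1) *: f.
  rewrite YkS // TT Yk_linear // YT YkZ // Yf // Tk_linear // !TkZ // TiT.
  by rewrite scalerDr !scalerA addrC; congr (_ *: _ + _ *: _); field.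
split=> [||j jN ji jSi].
- rewrite YkD // YkZ // YT Yf //.
  transitivity (y i.+1 *: T i f + (c * y i - y i.+1 * (t - 1)) *: f).
    by rewrite scalerBr !scalerA -addrA scalerBl [- _ + _]addrC.
  rewrite scalerDr !scalerA; congr (_ + _ *: _).
  by rewrite [_ * (t - 1)]mulrC -cE; ring.
- rewrite YkD // YkZ // YST (Yf _ iN) -addrA scalerA -scalerDl scalerDr scalerA.
  by congr (_ + _ *: _); rewrite -cE; ring.
- rewrite YkD // YkZ // -Yk_comm // ?[_ == j]eq_sym // 1?eq_sym // Yf // TkZ //.
  by rewrite scalerDr !scalerA mulrC.
Qed.

Lemma Yk1 i : (i <= N)%N -> Y i 1 = t ^- (N - i) *: 1.
Proof.
move=> iN; have T1 k : (k < N)%N -> T k 1 = t *: 1.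
  by move=> kN; rewrite /Tk demT1 ?idx_neqS // -mul_mpolyC mulr1.
have Ti1 k : (k < N)%N -> Tik k 1 = t^-1 *: 1.
  by move=> kN; rewrite TikE T1 // -scalerBl opprB addrC subrK scale1r.
have A1 : Ak i 1 = t ^+ i *: 1.
  elim: i iN => [|i IH] iN; first by rewrite /Ak /= scale1r.
  have AZ a g : Ak i (a *: g) = a *: Ak i g.
    rewrite /Ak; have : all (fun l => l < N)%N (iota 0 i).
      by apply/allP => l; rewrite mem_iota; lia.
    by elim: (iota _ _) => //= l s IHs /andP[kl /IHs ->]; rewrite TkZ.
  by rewrite AkS T1 // AZ IH ?(ltnW iN) // scalerA -exprS.
have B1 : Bk i 1 = t ^- (N - i) *: 1.
  rewrite /Bk; have : all (fun l => l < N)%N (iota i (N - i)).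
    by apply/allP => l; rewrite mem_iota; lia.
  rewrite -[in RHS](size_iota i (N - i)).
  elim: (iota _ _) => [|l s IH] /=; first by rewrite expr0 invr1 scale1r.
  by move=> /andP[lN /IH ->]; rewrite TikZ // Ti1 // scalerA exprS invfM mulrC.
have BZ a g : Bk i (a *: g) = a *: Bk i g.
  rewrite /Bk; have : all (fun l => l < N)%N (iota i (N - i)).
    by apply/allP => l; rewrite mem_iota; lia.
  by elim: (iota _ _) => //= l s IHs /andP[kl /IHs ->]; rewrite TikZ.
rewrite /Yk A1 omegaKZ {1}/omegaK msub1 BZ B1 !scalerA mulVf ?mul1r //.
exact: expf_neq0.
Qed.

Lemma Yeigen1 : Yeigen q t (0%MM : 'X_{1..N.+1}) (1 : poly).
Proof.
move=> i; rewrite YopK_Yk Yk1 ?leq_ord // /eigK mnm0E expr0 mul1r.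
congr (_^-1 *: _); congr (_ ^+ _); rewrite /rk.
have -> : [set j | beats 0%MM i j] = [set j : 'I_N.+1 | (i < j)%N].
  by apply/setP => j; rewrite !inE /beats !mnm0E; lia.
have -> : [set j : 'I_N.+1 | (i < j)%N] = ~: [set j : 'I_N.+1 | (j < i.+1)%N].
  by apply/setP => j; rewrite !inE; lia.
rewrite cardsCs setCK card_ord.
have -> : #|[set j : 'I_N.+1 | (j < i.+1)%N]| = i.+1; last by rewrite subSS.
have winj : injective (widen_ord (ltn_ord i)).
  by move=> a b /(congr1 val) /= ab; apply: val_inj.
rewrite -[RHS](card_ord i.+1) -[RHS](card_imset _ winj).
apply: eq_card => j; rewrite inE; apply/idP/imsetP => [ji|[k _ ->]].
  by exists (Ordinal ji) => //; apply: val_inj.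
exact: (ltn_ord k).
Qed.

Definition mswap k eta : 'X_{1..N.+1} :=
  [multinom eta (tperm (idx k) (idx k.+1) i) | i < N.+1].

(** Exchanging distinct adjacent parts carries all comparisons along. Equal parts are compared by
    position, so their ranks would not follow the exchange. *)
Lemma eigK_mswap k eta (i : 'I_N.+1) : (k < N)%N -> eta (idx k) != eta (idx k.+1) ->
  eigK q t (mswap k eta) i = eigK q t eta (tperm (idx k) (idx k.+1) i).
Proof.
move=> kN ek; rewrite /eigK mnmE; congr (_ * _^-1); congr (_ ^+ _).
apply/esym/eq_rk; first exact: perm_inj.
have vk : nat_of_ord (idx k) = k by rewrite inordK //; lia.
have vk1 : nat_of_ord (idx k.+1) = k.+1 by rewrite inordK.
have neq (a b : 'I_N.+1) : a <> b -> nat_of_ord a <> nat_of_ord b.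
  by move=> ab /val_inj.
move=> j; rewrite /beats !mnmE.
by case: (tpermP _ _ i) => [->|->|/neq + /neq];
  case: (tpermP _ _ j) => [->|->|/neq + /neq]; move: ek; rewrite ?vk ?vk1; lia.
Qed.

Lemma Yeigen_swap k eta c f : (k < N)%N -> eta (idx k) != eta (idx k.+1) ->
  c * (eigK q t eta (idx k) - eigK q t eta (idx k.+1))
    = (t - 1) * eigK q t eta (idx k.+1) ->
  Yeigen q t eta f -> Yeigen q t (mswap k eta) (T k f + c *: f).
Proof.
move=> kN ek cE Yf i; rewrite eigK_mswap // YopK_Yk.
have Yf' j : (j <= N)%N -> Y j f = eigK q t eta (idx j) *: f.
  by move=> jN; rewrite -Yf YopK_Yk inordK.
have [E1 E2 E3] := Yk_intertwine kN Yf' cE.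
case: tpermP => [->|->|ik ikS].
- by rewrite inordK ?E1 //; lia.
- by rewrite inordK ?E2.
- have iE : i = idx i by apply: val_inj; rewrite /= inordK.
  rewrite E3 -?iE //; first by rewrite -ltnS.
    by apply/eqP => e; apply: ik; rewrite iE e.
  by apply/eqP => e; apply: ikS; rewrite iE e.
Qed.

(** This is [(eta_n + 1, eta_1, ..., eta_(n-1))]. *)
Definition mraise eta : 'X_{1..N.+1} :=
  (U_(idx 0) + [multinom eta (ord_pred i) | i < N.+1])%MM.

Lemma mraiseE eta (i : 'I_N.+1) :
  mraise eta (ordS i) = ((val i == N) + eta i)%N.
Proof. by rewrite mnmDE mnm1E mnmE ordSK -ordS_eq0 -val_eqE /= inordK // eq_sym. Qed.

(** The last part wins ties; moved to the front it would lose them, but adding 1 makes up for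
    that. *)
Lemma rk_mraise eta (i : 'I_N.+1) : rk (mraise eta) (ordS i) = rk eta i.
Proof.
apply: eq_rk; first exact: ordS_inj.
move=> j; rewrite /beats !mraiseE /=.
have iN := ltn_ord i; have jN := ltn_ord j.
have [iE|iE] := eqVneq (val i) N; have [jE|jE] := eqVneq (val j) N;
  rewrite /= in iE jE; rewrite ?iE ?jE ?modnn ?modn_small //; lia.
Qed.

Lemma Yeigen_raise eta f : Yeigen q t eta f -> Yeigen q t (mraise eta) (Phik f).
Proof.
move=> Yf i; rewrite -[i]ord_predK; move: (ord_pred i) => {}i.
rewrite /eigK mraiseE rk_mraise YopK_Yk.
have Yf' j : (j <= N)%N -> Y j f = eigK q t eta (idx j) *: f.
  by move=> jN; rewrite -Yf YopK_Yk inordK.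
have iE : i = idx i by apply: val_inj; rewrite /= inordK.
have PZ a g : Phik (a *: g) = a *: Phik g.
  by rewrite /Phik WkZ scalerAr.
have [iN|iN] := eqVneq (val i) N.
  have -> : val (ordS i) = 0%N by apply/eqP; rewrite ordS_eq0 iN.
  have iE' : i = idx N by apply: val_inj; rewrite [RHS]/= inordK.
  rewrite Yk0_Phik // Yf' // PZ scalerA -iE'.
  by rewrite exprD expr1 /eigK mulrA.
have iN' : (i < N)%N by have := ltn_ord i; move: iN => /=; lia.
have -> : val (ordS i) = i.+1 by rewrite /= modn_small.
by rewrite YkS_Phik // Yf' ?(ltnW iN') // PZ -iE.
Qed.

Lemma mcoeff_msub_scale (c : 'I_N.+1 -> K) f (m : 'X_{1..N.+1}) :
  (msub c id f)@_m = \prod_i c i ^+ m i * f@_m.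
Proof.
elim/mpolyind: f => [|a m' f _ _ IH]; first by rewrite msub0 mcoeff0 mulr0.
rewrite msubD msubZ !mcoeffD !mcoeffZ IH mulrDr; congr (_ + _).
have -> : msub c id 'X_[m'] = (\prod_i c i ^+ m' i) *: 'X_[m'].
  rewrite msubE comp_mpolyX [in RHS]mpolyXE_id -scaler_prod.
  by apply: eq_bigr => i _; rewrite tnth_mktuple exprZn.
rewrite mcoeffZ mcoeffX; case: eqP => [->|_]; last by rewrite !mulr0.
by rewrite !mulr1 mulrC.
Qed.

Lemma mcoeff_Phik eta f : (Phik f)@_(mraise eta) = q ^- eta (idx N) * f@_eta.
Proof.
rewrite /Phik mulrC mcoeffMX /Wk.
(* The substitution is split into a scaling of the variables followed by a permutation of them, each
   with an evident effect on coefficients. *)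
have -> : msub (fun i : 'I_N.+1 => if val i == N then q^-1 else 1) (@ordS N.+1) f
        = msym (perm (@ordS_inj N.+1))
            (msub (fun i : 'I_N.+1 => if val i == N then q^-1 else 1) id f).
  rewrite -msub_perm msub_comp; apply: eq_msub => i /=; first by rewrite mulr1.
  by rewrite permE.
rewrite mcoeff_sym mcoeff_msub_scale.
have -> : [multinom [multinom eta (ord_pred i) | i < N.+1] (perm (@ordS_inj N.+1) i)
            | i < N.+1] = eta.
  by apply/mnmP => i; rewrite !mnmE permE ordSK.
congr (_ * _); rewrite (bigD1 (idx N)) //= inordK // eqxx exprVn big1 ?mulr1 //.
move=> i iN; rewrite ifN ?expr1n //; apply: contra iN => /eqP iN.
by apply/eqP/val_inj; rewrite /= inordK.
Qed.

Lemma mcoeff_Phik0 f (m : 'X_{1..N.+1}) : m (idx 0) = 0%N -> (Phik f)@_m = 0.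
Proof. exact: mcoeffXM0. Qed.


End CherednikOperators.


(** * Specialisation at q = 1 *)

Definition tq1 : Qt := ('X : {poly rat})%:F.

Section SpecialisationScalars.
Implicit Types (f g : Qqt) (c d : Qt).

Lemma spec_frac (a b : {poly {poly rat}}) : b.[1] != 0 ->
  coef_at_q1 (a%:F / b%:F) (a.[1]%:F / b.[1]%:F).
Proof. by move=> b1; exists a, b. Qed.

Lemma horner1_neq0 (b : {poly {poly rat}}) : b.[1] != 0 -> b != 0.
Proof. by apply: contraNneq => ->; rewrite horner0. Qed.

Lemma spec_unique f c d : coef_at_q1 f c -> coef_at_q1 f d -> c = d.
Proof.
move=> [a [b [b1 fE ->]]] [a' [b' [b1' fE' ->]]].
have F0 (u : {poly {poly rat}}) : u.[1] != 0 -> u%:F != 0.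
  by move=> u1; rewrite tofrac_eq0 horner1_neq0.
have : (a * b')%:F == (a' * b)%:F.
  rewrite !tofracM; have /eqP := etrans (esym fE) fE'.
  by rewrite eqr_div ?F0.
rewrite tofrac_eq => /eqP/(congr1 (fun u => u.[1])); rewrite !hornerM => E.
apply/eqP; rewrite eqr_div ?tofrac_eq0 //.
by rewrite -!tofracM E.
Qed.

Lemma spec_poly (a : {poly {poly rat}}) : coef_at_q1 a%:F a.[1]%:F.
Proof.
have := @spec_frac a 1; rewrite hornerC oner_eq0 => /(_ isT).
by rewrite !tofrac1 !divr1.
Qed.

Lemma spec0 : coef_at_q1 0 0.
Proof. by have := spec_poly 0; rewrite horner0 !tofrac0. Qed.

Lemma spec1 : coef_at_q1 1 1.
Proof. by have := spec_poly 1; rewrite hornerC !tofrac1. Qed.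

Lemma spec_q : coef_at_q1 q_ 1.
Proof. by have := spec_poly 'X; rewrite hornerX tofrac1. Qed.

Lemma spec_t : coef_at_q1 t_ tq1.
Proof. by have := spec_poly ('X%:P); rewrite hornerC. Qed.

Lemma specD f g c d : coef_at_q1 f c -> coef_at_q1 g d -> coef_at_q1 (f + g) (c + d).
Proof.
move=> [a [b [b1 -> ->]]] [a' [b' [b1' -> ->]]].
have bb : (b * b').[1] != 0 by rewrite hornerM mulf_neq0.
have := spec_frac (a * b' + a' * b) bb.
rewrite !addf_div ?tofrac_eq0 ?horner1_neq0 //.
by rewrite !(hornerD, hornerM) !(tofracD, tofracM).
Qed.

Lemma specM f g c d : coef_at_q1 f c -> coef_at_q1 g d -> coef_at_q1 (f * g) (c * d).
Proof.
move=> [a [b [b1 -> ->]]] [a' [b' [b1' -> ->]]].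
have bb : (b * b').[1] != 0 by rewrite hornerM mulf_neq0.
have := spec_frac (a * a') bb.
by rewrite !mulf_div !hornerM !tofracM.
Qed.

Lemma specN f c : coef_at_q1 f c -> coef_at_q1 (- f) (- c).
Proof.
move=> H; have := specM (spec_poly (-1)) H.
by rewrite hornerN hornerC !tofracN !tofrac1 !mulN1r.
Qed.

Lemma specV f c : c != 0 -> coef_at_q1 f c -> coef_at_q1 f^-1 c^-1.
Proof.
move=> c0 [a [b [b1 fE cE]]].
have a1 : a.[1] != 0.
  by apply: contraNneq c0 => a1; rewrite cE a1 tofrac0 mul0r.
have := spec_frac b a1.
by rewrite fE cE !invf_div.
Qed.

Lemma specX f c k : coef_at_q1 f c -> coef_at_q1 (f ^+ k) (c ^+ k).
Proof.
move=> H; elim: k => [|k IH]; first exact: spec1.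
by rewrite !exprS; apply: specM.
Qed.

Lemma spec_sum (I : Type) (r : seq I) (P : pred I) (F : I -> Qqt) (G : I -> Qt) :
  (forall i, coef_at_q1 (F i) (G i)) ->
  coef_at_q1 (\sum_(i <- r | P i) F i) (\sum_(i <- r | P i) G i).
Proof.
move=> FG; elim/big_rec2: _ => [|i c f _ H]; first exact: spec0.
exact: specD.
Qed.

Lemma tq1_neq0 : tq1 != 0.
Proof. by rewrite tofrac_eq0 polyX_eq0. Qed.

Lemma tq1X_inj a b : tq1 ^- a = tq1 ^- b -> a = b.
Proof.
move=> /(congr1 (@GRing.inv _)); rewrite !invrK -!tofracXn => /eqP.
rewrite tofrac_eq => /eqP/(congr1 (fun p : {poly rat} => size p)).
by rewrite !size_polyXn => -[].
Qed.

Lemma t_neq0 : t_ != 0.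
Proof. by rewrite tofrac_eq0 polyC_eq0 polyX_eq0. Qed.

Lemma q_neq0 : q_ != 0.
Proof. by rewrite tofrac_eq0 polyX_eq0. Qed.

(** After clearing powers of [t], the degrees in [q] are compared. Thus for generic [q] the joint
    eigenvalue determines the composition. *)
Lemma qt_mono_inj a b a' b' : q_ ^+ a * t_ ^- b = q_ ^+ a' * t_ ^- b' -> a = a'.
Proof.
move=> E; have : q_ ^+ a * t_ ^+ b' = q_ ^+ a' * t_ ^+ b.
  have tb k : t_ ^+ k != 0 by rewrite expf_neq0 // t_neq0.
  by apply/eqP; rewrite -eqr_div // E.
rewrite /q_ /t_ -!tofracXn -!tofracM => /eqP; rewrite tofrac_eq -!polyC_exp => /eqP.
move=> /(congr1 (fun p : {poly {poly rat}} => size p)).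
have szE (c k : nat) : size ('X^c * ('X^k)%:P : {poly {poly rat}}) = c.+1.
  rewrite mulrC mul_polyC size_scale ?size_polyXn //.
  by rewrite expf_neq0 // polyX_eq0.
by rewrite !szE => -[].
Qed.

End SpecialisationScalars.

Section SpecialisationOperators.
Variable n : nat.
Implicit Types (f g : {mpoly Qqt[n]}) (P Q : {mpoly Qt[n]}).

Lemma at_q1_unique f P Q : at_q1 f P -> at_q1 f Q -> P = Q.
Proof. by move=> HP HQ; apply/mpolyP => m; apply: spec_unique (HP m) (HQ m). Qed.

Lemma at_q1_0 : at_q1 (0 : {mpoly Qqt[n]}) 0.
Proof. by move=> m; rewrite !mcoeff0; apply: spec0. Qed.

Lemma at_q1_X (k : 'X_{1..n}) : at_q1 ('X_[k] : {mpoly Qqt[n]}) 'X_[k].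
Proof.
by move=> m; rewrite !mcoeffX; case: eqP => _; [apply: spec1 | apply: spec0].
Qed.

Lemma at_q1_1 : at_q1 (1 : {mpoly Qqt[n]}) 1.
Proof. by rewrite -!mpolyX0; apply: at_q1_X. Qed.

Lemma at_q1D f g P Q : at_q1 f P -> at_q1 g Q -> at_q1 (f + g) (P + Q).
Proof. by move=> HP HQ m; rewrite !mcoeffD; apply: specD. Qed.

Lemma at_q1N f P : at_q1 f P -> at_q1 (- f) (- P).
Proof. by move=> HP m; rewrite !mcoeffN; apply: specN. Qed.

Lemma at_q1Z a b f P : coef_at_q1 a b -> at_q1 f P -> at_q1 (a *: f) (b *: P).
Proof. by move=> Ha HP m; rewrite !mcoeffZ; apply: specM. Qed.

Lemma at_q1M f g P Q : at_q1 f P -> at_q1 g Q -> at_q1 (f * g) (P * Q).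
Proof. by move=> HP HQ m; rewrite !mcoeffM; apply: spec_sum => k; apply: specM. Qed.

Lemma at_q1_msym s f P : at_q1 f P -> at_q1 (msym s f) (msym s P).
Proof. by move=> HP m; rewrite !mcoeff_sym; apply: HP. Qed.

Lemma at_q1_Xind (R : {mpoly Qqt[n]} -> {mpoly Qt[n]} -> Prop) :
  R 1 1 -> (forall i, R 'X_i 'X_i) ->
  (forall f g P Q, R f P -> R g Q -> R (f * g) (P * Q)) ->
  forall m, R 'X_[m] 'X_[m].
Proof.
move=> R1 RX RM m; rewrite !mpolyXE_id.
elim/big_rec2: _ => // k P f _ H; apply: (RM) => //.
by elim: (m k) => [|e IH]; rewrite ?expr0 // !exprS; apply: (RM).
Qed.

Lemma linear_sum_op (K : fieldType) (F : {mpoly K[n]} -> {mpoly K[n]})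
    (I : finType) (a : I -> K) (b : I -> {mpoly K[n]}) :
  (forall c u v, F (c *: u + v) = c *: F u + F v) ->
  F (\sum_i a i *: b i) = \sum_i a i *: F (b i).
Proof.
move=> Flin; elim/big_rec2: _ => [|i u v _ <-]; last by rewrite Flin.
by have := Flin (-1) 0 0; rewrite scaler0 addr0 scaleN1r addNr.
Qed.

Lemma at_q1_sum (I : finType) (u : I -> {mpoly Qqt[n]}) (v : I -> {mpoly Qt[n]}) :
  (forall i, at_q1 (u i) (v i)) -> at_q1 (\sum_i u i) (\sum_i v i).
Proof. by move=> H m; rewrite !raddf_sum /=; apply: spec_sum => i; apply: H. Qed.

(** Reduces compatibility of a linear operator with the specialisation to monomials. *)
Lemma at_q1_op (F : {mpoly Qqt[n]} -> {mpoly Qqt[n]})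
    (G : {mpoly Qt[n]} -> {mpoly Qt[n]}) f P :
  (forall c u v, F (c *: u + v) = c *: F u + F v) ->
  (forall c u v, G (c *: u + v) = c *: G u + G v) ->
  (forall m, at_q1 (F 'X_[m]) (G 'X_[m])) ->
  at_q1 f P -> at_q1 (F f) (G P).
Proof.
move=> Flin Glin FG HP.
(* A common degree bound writes [f] and [P] as sums over the same monomials. *)
have [k le1 le2] : exists2 k, (msize f <= k)%N & (msize P <= k)%N.
  by exists (maxn (msize f) (msize P)); rewrite (leq_maxl, leq_maxr).
rewrite (mpolywE le1) (mpolywE le2) (linear_sum_op _ _ Flin) (linear_sum_op _ _ Glin).
by apply: at_q1_sum => m; apply: at_q1Z.
Qed.

(** A twisted Leibniz rule. As [divdiff] is obtained by choice, its specialisation is derived from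
    its values on 1 and the variables, which this rule extends to all monomials. *)
Lemma divdiffM (K : fieldType) (i j : 'I_n) (f g : {mpoly K[n]}) : i != j ->
  divdiff i j (f * g) = divdiff i j f * g + msym (tperm i j) f * divdiff i j g.
Proof.
move=> ij; apply: divdiff_unique => //.
move: (divdiffP i j f) (divdiffP i j g); rewrite msymM.
move: ('X_i - 'X_j) (divdiff i j f) (divdiff i j g) (msym _ f) (msym _ g).
move=> d a b sf sg Ha Hb.
by rewrite mulrDr mulrA Ha mulrCA Hb; ring.
Qed.

Lemma at_q1_divdiff (i j : 'I_n) f P : i != j ->
  at_q1 f P -> at_q1 (divdiff i j f) (divdiff i j P).
Proof.
move=> ij; apply: at_q1_op => [c u v|c u v|m]; try exact: divdiff_linear.
(* The first component is carried along because the factors themselves occur in the Leibniz rule. *)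
pose R u v := at_q1 u v /\ at_q1 (divdiff i j u) (divdiff i j v).
suff [] : R 'X_[m] 'X_[m] by [].
have dC (K : fieldType) : divdiff i j (1 : {mpoly K[n]}) = 0.
  by apply: divdiff_unique => //; rewrite mulr0 msym1 subrr.
have dX (K : fieldType) k : divdiff i j ('X_k : {mpoly K[n]})
    = (if k == i then 1 else if k == j then -1 else 0).
  apply: divdiff_unique => //; rewrite msymXU.
  case: tpermP => [->|->|/eqP/negbTE-> /eqP/negbTE->].
  - by rewrite eqxx mulr1.
  - by rewrite eq_sym (negbTE ij) eqxx mulrN1 opprB.
  - by rewrite mulr0 subrr.
apply: at_q1_Xind.
- by split; [apply: at_q1_1 | rewrite !dC; apply: at_q1_0].
- move=> k; split; first exact: at_q1_X.
  rewrite !dX; case: eqP => _; first exact: at_q1_1.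
  by case: eqP => _; [apply/at_q1N/at_q1_1 | apply: at_q1_0].
- move=> u v U V [uU duU] [vV dvV]; split; first exact: at_q1M.
  rewrite !divdiffM //; apply: at_q1D; first exact: at_q1M.
  by apply: at_q1M => //; apply: at_q1_msym.
Qed.

Lemma at_q1_msub c d p f P : (forall i, coef_at_q1 (c i) (d i)) ->
  at_q1 f P -> at_q1 (msub c p f) (msub d p P).
Proof.
move=> cd; apply: at_q1_op => [a u v|a u v|m]; try by rewrite msubD msubZ.
apply: (at_q1_Xind (R := fun u v => at_q1 (msub c p u) (msub d p v))).
- by rewrite !msub1; apply: at_q1_1.
- by move=> i; rewrite !msubXU; apply: at_q1Z => //; apply: at_q1_X.
- by move=> u v U V uU vV; rewrite !msubM; apply: at_q1M.
Qed.

Lemma at_q1_demT (i j : 'I_n) f P : i != j ->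
  at_q1 f P -> at_q1 (demT t_ i j f) (demT tq1 i j P).
Proof.
move=> ij H; rewrite !demT_def; apply: at_q1D; first exact: at_q1Z spec_t H.
apply/at_q1N/at_q1M; last exact: at_q1_divdiff.
apply: at_q1D; last exact/at_q1N/at_q1_X.
exact/at_q1Z/at_q1_X/spec_t.
Qed.

Lemma spec_tV k : coef_at_q1 (t_ ^- k) (tq1 ^- k).
Proof. by apply/specV/specX/spec_t; rewrite expf_neq0 // tq1_neq0. Qed.

Lemma at_q1_demTinv (i j : 'I_n) f P : i != j ->
  at_q1 f P -> at_q1 (demTinv t_ i j f) (demTinv tq1 i j P).
Proof.
move=> ij H; rewrite !demTinvE; apply: at_q1Z; first exact: spec_tV 1%N.
apply: at_q1D; first exact: at_q1_demT.
apply/at_q1N/at_q1Z => //; apply: specD; first exact: spec_t.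
exact/specN/spec1.
Qed.

Lemma at_q1_YopK (i : 'I_n) f P :
  at_q1 f P -> at_q1 (YopK q_ t_ i f) (YopK 1 tq1 i P).
Proof.
move=> H; rewrite /YopK; apply: at_q1Z; first exact: spec_tV.
have neqS (k : 'I_n) : (k.+1 < n)%N -> k != ordS k.
  by move=> kn; rewrite -val_eqE /= modn_small // neq_ltn leqnn.
have : all (fun k : 'I_n => (k.+1 < n)%N)
    [seq k : 'I_n <- enum 'I_n | (i <= k)%N && (k.+1 < n)%N].
  by apply/allP => k; rewrite mem_filter => /andP[/andP[]].
elim: [seq _ <- _ | _ ] => /= [_|k s IH /andP[kn /IH ?]]; last first.
  by apply: at_q1_demTinv => //; apply: neqS.
apply: at_q1_msub => [k|].
  by case: ifP => _; [apply: spec_q | apply: spec1].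
have : all (fun k : 'I_n => (k.+1 < n)%N) [seq k : 'I_n <- enum 'I_n | (k < i)%N].
  apply/allP => k; rewrite mem_filter => /andP[ki _].
  exact: leq_ltn_trans ki (ltn_ord i).
elim: [seq _ <- _ | _ ] => //= k s IH /andP[kn /IH ?].
by apply: at_q1_demT => //; apply: neqS.
Qed.

Lemma spec_eigK (eta : 'X_{1..n}) i :
  coef_at_q1 (eigK q_ t_ eta i) (tq1 ^- rk eta i).
Proof.
rewrite -[X in coef_at_q1 _ X]mul1r -(expr1n _ (eta i)).
by apply: specM; [apply/specX/spec_q | apply: spec_tV].
Qed.

Lemma Yeigen_at_q1 (eta : 'X_{1..n}) f P : at_q1 f P -> Yeigen q_ t_ eta f ->
  forall i, YopK 1 tq1 i P = tq1 ^- rk eta i *: P.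
Proof.
move=> HP Yf i; apply: at_q1_unique (at_q1_YopK i HP) _.
by rewrite Yf; apply: at_q1Z => //; apply: spec_eigK.
Qed.

Lemma eigvalE (eta : 'X_{1..n}) i : eigval eta i = eigK q_ t_ eta i.
Proof. by rewrite /eigval -rkE. Qed.

End SpecialisationOperators.


(** * Recursive construction and uniqueness *)

Section DegreeBounds.
Variables (K : fieldType) (n : nat).
Implicit Types (f g : {mpoly K[n]}).

Lemma msize_leP f k : reflect (forall m, (k <= mdeg m)%N -> f@_m = 0) (msize f <= k)%N.
Proof.
apply: (iffP idP) => [fk m km|H].
  by apply/memN_msupp_eq0/msize_mdeg_ge/(leq_trans fk).
rewrite msizeE; apply/bigmax_leqP_seq => m; rewrite mcoeff_msupp => fm _.
by rewrite ltnNge; apply: contra fm => /H ->.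
Qed.

Lemma msizeD_le f g k : (msize f <= k)%N -> (msize g <= k)%N -> (msize (f + g) <= k)%N.
Proof. by move=> fk gk; rewrite (leq_trans (mmeasureD_le _ _ _)) // geq_max fk. Qed.

Lemma msize_msym s f : (msize (msym s f) <= msize f)%N.
Proof.
apply/msize_leP => m fm; rewrite mcoeff_sym.
by apply/memN_msupp_eq0/msize_mdeg_ge; rewrite mdeg_mperm.
Qed.

Lemma msizeXB (i j : 'I_n) : i != j -> (1 < msize ('X_i - 'X_j : {mpoly K[n]}))%N.
Proof.
move=> ij; rewrite -(mdeg1 i); apply: msize_mdeg_lt.
rewrite mcoeff_msupp mcoeffB !mcoeffX eqxx eq_mnm1.
by rewrite [j == i]eq_sym (negbTE ij) subr0 oner_eq0.
Qed.

(** Dividing by [x_i - x_j] lowers the degree by one, and the factor [t x_i - x_j] raises it by at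
    most one. *)
Lemma msize_demT t (i j : 'I_n) f : i != j -> (msize (demT t i j f) <= msize f)%N.
Proof.
move=> ij; rewrite demT_def; apply: msizeD_le; first exact: msizeZ_le.
rewrite mmeasureN; have [->|g0] := eqVneq (divdiff i j f) 0.
  by rewrite mulr0 mmeasure0.
have := msizeM (mpolyXB_neq0 K ij) g0; rewrite divdiffP => E.
have : (msize (f - msym (tperm i j) f) <= msize f)%N.
  by apply: msizeD_le; rewrite ?mmeasureN ?msize_msym.
have h0 : t *: 'X_i - 'X_j != 0 :> {mpoly K[n]}.
  apply/eqP => /(congr1 (mcoeff U_(j))) /eqP.
  rewrite mcoeffB mcoeffZ !mcoeffX eqxx eq_mnm1 (negbTE ij) mulr0 sub0r mcoeff0.
  by rewrite oppr_eq0 oner_eq0.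
rewrite E (msizeM h0 g0) => le.
have : (msize (t *: 'X_i - 'X_j : {mpoly K[n]}) <= 2)%N.
  apply: msizeD_le; first by rewrite (leq_trans (msizeZ_le _ _)) // msizeX mdeg1.
  by rewrite mmeasureN msizeX mdeg1.
move=> le2; apply: leq_trans le.
by rewrite -!subn1 leq_sub2r // leq_add2r (leq_trans le2) // msizeXB.
Qed.

End DegreeBounds.

Lemma msize_Phik (K : fieldType) N (q : K) (f : {mpoly K[N.+1]}) :
  (msize (Phik q f) <= (msize f).+1)%N.
Proof.
have le (g : {mpoly K[N.+1]}) k :
    (msize g <= k)%N -> (msize ('X_(inord 0) * g) <= k.+1)%N.
  have [->|g0] := eqVneq g 0; first by rewrite mulr0 mmeasure0.
  have X0 : 'X_(inord 0) != 0 :> {mpoly K[N.+1]} by rewrite -msize_poly_eq0 msizeX.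
  by rewrite (msizeM X0 g0) msizeX mdeg1.
apply: le; apply/msize_leP => m fm; rewrite /Wk.
have -> : msub (fun i : 'I_N.+1 => if val i == N then q^-1 else 1) (@ordS N.+1) f
        = msym (perm (@ordS_inj N.+1))
            (msub (fun i : 'I_N.+1 => if val i == N then q^-1 else 1) id f).
  rewrite -msub_perm msub_comp; apply: eq_msub => i /=; first by rewrite mulr1.
  by rewrite permE.
rewrite mcoeff_sym mcoeff_msub_scale; apply/eqP; rewrite mulf_eq0; apply/orP; right.
by apply/eqP/memN_msupp_eq0/msize_mdeg_ge; rewrite mdeg_mperm.
Qed.

Section RegularMacdonald.
Variable n : nat.
Implicit Types (eta : 'X_{1..n}) (E : {mpoly Qqt[n]}).

(** The degree bound places [E] in a finite-dimensional space in which its eigenvalues and leading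
    coefficient determine it. *)
Definition regular_nsMac eta E :=
  [/\ E@_eta = 1, Yeigen q_ t_ eta E, (msize E <= (mdeg eta).+1)%N
    & exists P, at_q1 E P].

End RegularMacdonald.

Section Construction.
Variable N : nat.
Local Notation idx k := (inord k : 'I_N.+1).
Implicit Types (eta zeta : 'X_{1..N.+1}) (E : {mpoly Qqt[N.+1]}).

Lemma YeigenZ (K : fieldType) (q t : K) eta c (f : {mpoly K[N.+1]}) :
  q != 0 -> t != 0 -> Yeigen q t eta f -> Yeigen q t eta (c *: f).
Proof.
move=> q0 t0 Yf i; rewrite YopK_Yk // YkZ // ?leq_ord // -YopK_Yk // Yf.
by rewrite !scalerA mulrC.
Qed.

Lemma mswapK k eta : mswap k (mswap k eta) = eta.
Proof. by apply/mnmP => i; rewrite !mnmE tpermK. Qed.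

Lemma mdeg_mswap k eta : mdeg (mswap k eta) = mdeg eta.
Proof. exact: mdeg_mperm. Qed.

Lemma mdeg_mraise eta : mdeg (mraise eta) = (mdeg eta).+1.
Proof.
rewrite mdegD mdeg1 add1n !mdegE; congr _.+1.
rewrite [RHS](reindex_inj (@ord_pred_inj N.+1)) /=.
by apply: eq_bigr => i _; rewrite mnmE.
Qed.

Lemma mraise_onto eta : eta (idx 0) != 0%N -> exists nu, eta = mraise nu.
Proof.
move=> e0; exists [multinom (eta (ordS i) - (val i == N))%N | i < N.+1].
apply/mnmP => i; rewrite -[i]ord_predK mraiseE mnmE; move: (ord_pred i) => {}i.
case: eqP => [iN|_]; last by rewrite subn0.
have -> : ordS i = idx 0.
  by apply: val_inj; rewrite [RHS]/= inordK //; apply/eqP; rewrite ordS_eq0 iN.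
by rewrite subnKC // lt0n.
Qed.

Lemma at_q1_Phik E P : at_q1 E P -> at_q1 (Phik q_ E) (Phik 1 P).
Proof.
move=> H; apply: at_q1M; first exact: at_q1_X.
apply: at_q1_msub => // i; case: ifP => _; last exact: spec1.
by apply: specV (oner_neq0 _) spec_q.
Qed.

Lemma mcoeff_Phik_scaled (K : fieldType) (q t : K) eta f : q != 0 -> t != 0 ->
  (q ^+ eta (idx N) *: Phik q f)@_(mraise eta) = f@_eta.
Proof.
by move=> q0 t0; rewrite mcoeffZ mcoeff_Phik // mulrA mulfV ?mul1r // expf_neq0.
Qed.

Lemma mcoeff_Tk_swap (K : fieldType) (t c : K) m f eta :
  eta (idx m) = 0%N -> f@_eta = 0 ->
  (Tk t m f + c *: f)@_eta = f@_(mswap m eta).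
Proof.
move=> em f0; rewrite mcoeffD mcoeffZ /Tk mcoeff_demT0 // f0.
by rewrite !mulr0 add0r addr0.
Qed.

(** At [q = 1] the two eigenvalues are powers of [t] with distinct ranks as exponents; a difference
    that is nonzero there is nonzero for generic [q]. *)
Lemma spec_eigKB eta (i j : 'I_N.+1) : i != j ->
  eigK q_ t_ eta i - eigK q_ t_ eta j != 0
  /\ tq1 ^- rk eta i - tq1 ^- rk eta j != 0.
Proof.
move=> ij; have n0 : tq1 ^- rk eta i - tq1 ^- rk eta j != 0.
  by rewrite subr_eq0; apply: contra ij => /eqP/tq1X_inj/rk_inj ->.
split=> //; apply: contraNneq n0 => E0; apply/eqP.
apply: spec_unique spec0; rewrite -E0; apply: specD; first exact: spec_eigK.
exact/specN/spec_eigK.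
Qed.

(** Induction on the position [m] of the first nonzero part: at 0, [eta] is raised from a
    composition of smaller degree; otherwise it is an exchange away from position [m - 1]. The
    vanishing of the coefficients whose exponents are zero up to [m] keeps the leading coefficient
    equal to 1, since the summand [c *: E] then does not contribute to it. *)
Lemma regular_nsMac_step m eta :
  (forall nu, (mdeg nu < mdeg eta)%N -> exists E, regular_nsMac nu E) ->
  (m <= N)%N -> (forall i, (i < m)%N -> eta (idx i) = 0%N) -> eta (idx m) != 0%N ->
  exists2 E, regular_nsMac eta E
    & forall zeta, (forall i, (i <= m)%N -> zeta (idx i) = 0%N) -> E@_zeta = 0.
Proof.
have q0 := q_neq0; have t0 := t_neq0.
elim: m eta => [|m IH] eta IHd mN z em.
  have [nu nuE] := mraise_onto em.
  have [|E [E1 EY Esz [P EP]]] := IHd nu; first by rewrite nuE mdeg_mraise.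
  (* The scalar cancels the power of [q] that [omega^-1] puts on the leading monomial. *)
  exists (q_ ^+ nu (idx N) *: Phik q_ E); last first.
    by move=> zeta z0; rewrite mcoeffZ mcoeff_Phik0 ?z0 // mulr0.
  split.
  - by rewrite nuE (mcoeff_Phik_scaled _ _ q0 t0).
  - by rewrite nuE; apply: YeigenZ => //; apply: Yeigen_raise.
  - rewrite nuE mdeg_mraise (leq_trans (msizeZ_le _ _)) //.
    exact: leq_trans (msize_Phik _ _) _.
  - exists (1 ^+ nu (idx N) *: Phik 1 P).
    by apply: at_q1Z; [apply/specX/spec_q | apply: at_q1_Phik].
have mN' : (m <= N)%N by exact: ltnW.
have neqS : idx m != idx m.+1 by exact: idx_neqS.
have eqd i : (i < m)%N -> tperm (idx m) (idx m.+1) (idx i) = idx i.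
  by move=> im; rewrite tpermD // idx_neq //; lia.
have [||||E [E1 EY Esz [P EP]] E0] := IH (mswap m eta).
- by move=> nu; rewrite mdeg_mswap; apply: IHd.
- by [].
- by move=> i im; rewrite mnmE eqd // z //; lia.
- by rewrite mnmE tpermL.
pose y := eigK q_ t_ (mswap m eta).
pose c := (t_ - 1) * y (idx m.+1) / (y (idx m) - y (idx m.+1)).
have [yn0 tn0] := spec_eigKB (mswap m eta) neqS.
exists (Tk t_ m E + c *: E); last first.
  move=> zeta z0; rewrite mcoeff_Tk_swap ?z0 //; last first.
    by apply: E0 => i im; apply: z0; lia.
  apply: E0 => i im; rewrite mnmE.
  have [->|im'] := eqVneq i m; first by rewrite tpermL z0.
  by rewrite eqd ?z0 //; lia.
split.
- rewrite mcoeff_Tk_swap ?z //.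
  by apply: E0 => i im; apply: z; lia.
- rewrite -[eta](mswapK m); apply: Yeigen_swap => //; last exact: divfK.
  by rewrite !mnmE tpermL tpermR (z m).
- rewrite mdeg_mswap in Esz; apply: msizeD_le.
    by apply: leq_trans Esz; apply: msize_demT.
  exact: leq_trans (msizeZ_le _ _) Esz.
(* The scalar in front of [P] is the value of [c] at [q = 1]. *)
- exists (demT tq1 (idx m) (idx m.+1) P
    + ((tq1 - 1) * tq1 ^- rk (mswap m eta) (idx m.+1)
       / (tq1 ^- rk (mswap m eta) (idx m) - tq1 ^- rk (mswap m eta) (idx m.+1))) *: P).
  apply: at_q1D; first exact: at_q1_demT.
  apply: at_q1Z => //; apply: specM.
    apply: specM; last exact: spec_eigK.
    by apply: specD; [apply: spec_t | apply/specN/spec1].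
  apply: specV => //; apply: specD; first exact: spec_eigK.
  exact/specN/spec_eigK.
Qed.

End Construction.

Lemma regular_nsMac_exists n (eta : 'X_{1..n}) : exists E, regular_nsMac eta E.
Proof.
case: n eta => [|N] eta.
  exists 1; split; first by rewrite mcoeff1; case: eqP => // -[]; apply/mnmP => -[].
  - by case.
  - by rewrite msize1.
  - by exists 1; apply: at_q1_1.
elim/ltn_ind: {eta}(mdeg eta) {-2}eta (erefl (mdeg eta)) => d IH eta dE.
have [e0|e0] := eqVneq eta 0%MM.
  exists 1; split; first by rewrite e0 mcoeff1 eqxx.
  - rewrite e0; apply: Yeigen1; [exact: q_neq0 | exact: t_neq0].
  - by rewrite msize1.
  - by exists 1; apply: at_q1_1.
have ex : exists m, (m <= N)%N && (eta (inord m : 'I_N.+1) != 0%N).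
  have /existsP[i ei] : [exists i : 'I_N.+1, eta i != 0%N].
    apply: contraR e0; rewrite negb_exists => /forallP H.
    by apply/eqP/mnmP => i; rewrite mnm0E; have := H i; rewrite negbK => /eqP.
  by exists i; rewrite -ltnS ltn_ord inord_val.
case: (ex_minnP ex) => m /andP[mN em] min.
have [||E H _] := @regular_nsMac_step N m eta _ mN _ em.
- by move=> nu nud; apply: (IH (mdeg nu)) => //; rewrite -dE.
- move=> i im; apply/eqP; apply: contraTT (im) => ei; rewrite -leqNgt.
  by apply: min; rewrite ei andbT (leq_trans (ltnW im)).
by exists E.
Qed.

Lemma YopK_linear (K : fieldType) n (q t : K) (i : 'I_n) a f g :
  q != 0 -> t != 0 ->
  YopK q t i (a *: f + g) = a *: YopK q t i f + YopK q t i g.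
Proof.
move=> q0 t0; case: n i f g => [[]//|N] i f g.
by rewrite !YopK_Yk // Yk_linear // -ltnS.
Qed.

(** The family [e] and the monomials of degree below [d] have the same index set, so the abstract
    lemma applies with the monomials as spanning vectors. *)
Lemma Yeigen_dim1 (K : fieldType) n (q t : K) d
    (e : 'X_{1..n < d} -> {mpoly K[n]}) (eta : 'X_{1..n < d}) (v : {mpoly K[n]}) :
  q != 0 -> t != 0 ->
  (forall a b a' b', q ^+ a * t ^- b = q ^+ a' * t ^- b' -> a = a') ->
  (forall nu : 'X_{1..n < d}, Yeigen q t nu (e nu)) ->
  (forall nu : 'X_{1..n < d}, (e nu)@_nu = 1) ->
  (forall nu, (msize (e nu) <= d)%N) ->
  (msize v <= d)%N -> Yeigen q t eta v -> v = v@_eta *: e eta.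
Proof.
move=> q0 t0 qt_inj eY e1 esz vsz Yv.
suff [k kE] : exists k, v = k *: e eta by rewrite {1}kE kE mcoeffZ e1 mulr1.
apply: (@joint_eigenspace_dim1 _ _ 'I_n 'X_{1..n < d} 'X_{1..n < d}
  (fun i => YopK q t i) (fun nu i => eigK q t nu i) e _ _ _ _ (erefl _)
  (fun m => 'X_[m]) (fun nu m => (e nu)@_m) _ v (fun m => v@_m)).
- by move=> i a u w; rewrite YopK_linear.
- by move=> i nu; apply: eY.
- move=> nu; apply: contra_eqN (e1 nu) => /eqP ->.
  by rewrite mcoeff0 eq_sym oner_eq0.
- move=> nu nu' H; apply: val_inj; apply/mnmP => i.
  exact: qt_inj (H i).
- by move=> nu; apply: mpolywE.
- exact: mpolywE.
- exact: Yv.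
Qed.

Lemma nsMac_regular n (eta : 'X_{1..n}) E : is_nsMacdonald eta E -> regular_nsMac eta E.
Proof.
move=> [_ E1 EY].
have [E0 [E01 E0Y E0sz E0P]] := regular_nsMac_exists eta.
suff -> : E = E0 by split.
(* Bounds the degrees of [E] and [E0] at once; both will equal the member [eta] of the family [e]
   constructed for this range of degrees. *)
pose d := maxn (msize E) (mdeg eta).+1.
have ed : (mdeg eta < d)%N by rewrite leq_maxr.
have [e eP] := fin_all_exists (fun nu : 'X_{1..n < d} => regular_nsMac_exists nu).
have dim1 := @Yeigen_dim1 _ n q_ t_ d e (BMultinom ed) _ q_neq0 t_neq0 qt_mono_inj.
have {}dim1 v : (msize v <= d)%N -> Yeigen q_ t_ eta v -> v@_eta = 1 ->
    v = e (BMultinom ed).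
  move=> vsz Yv v1; rewrite -[RHS]scale1r -v1; apply: dim1 => // nu.
  - by have [_ ? _ _] := eP nu.
  - by have [? _ _ _] := eP nu.
  - by have [_ _ sz _] := eP nu; apply: leq_trans sz (bmdeg nu).
rewrite (dim1 E) ?leq_maxl //; first rewrite (dim1 E0) //.
  exact: leq_trans E0sz ed.
by move=> i; rewrite -YopKE EY eigvalE.
Qed.


(** * Orbit vectors at q = 1 *)

Section OrbitSpace.
Variables (K : fieldType) (n : nat) (t : K) (L : fieldType).
Variable iota : {rmorphism {mpoly K[n]} -> L}.
Hypothesis iota_inj : injective iota.
Local Notation x i := (iota 'X_i).
Local Notation tau := (iota t%:MP).
Local Notation V := {ffun 'S_n -> L^o}.
Implicit Types (v w : V) (f g P : {mpoly K[n]}) (i j k : 'I_n).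

(* At [q = 1] the operators lie in the twisted group algebra of ['S_n] over the   *)
(* field of rational functions, so they act linearly over that field on the      *)
(* orbit vectors [(s f)_s], which live in a space of dimension [n!].              *)
Definition orbv f : V := [ffun s : 'S_n => symv iota s f : L^o].

Definition orbT i j v : V :=
  [ffun s : 'S_n => ((1 - tau) * x (s j) * v s
    + (tau * x (s i) - x (s j)) * v (tperm i j * s)%g) / (x (s i) - x (s j)) : L^o].

Definition orbTinv i j v : V := tau^-1 *: (orbT i j v - (tau - 1) *: v).

Definition orbomega v : V := [ffun s : 'S_n => v (perm (@ord_pred_inj n) * s)%g].

Definition orbY i v : V :=
  tau ^- i *:
    foldr (fun k => orbTinv k (ordS k))
      (orbomega (foldr (fun k => orbT k (ordS k)) v
                 [seq k : 'I_n <- enum 'I_n | (k < i)%N]))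
      [seq k : 'I_n <- enum 'I_n | (i <= k)%N && (k.+1 < n)%N].

Lemma orbT_linear i j a v w : orbT i j (a *: v + w) = a *: orbT i j v + orbT i j w.
Proof.
apply/ffunP => s; rewrite !ffunE.
have sc (b c : L) : b *: (c : L^o) = b * c by [].
rewrite !sc; move: (v _) (v _) (w _) (w _) (x _) (x _) tau => v1 v2 w1 w2 x1 x2 b.
rewrite mulrA -mulrDl; congr (_ / _); ring.
Qed.

Lemma orbTinv_linear i j a v w :
  orbTinv i j (a *: v + w) = a *: orbTinv i j v + orbTinv i j w.
Proof.
rewrite /orbTinv orbT_linear; move: (orbT i j v) (orbT i j w) => v' w'.
rewrite scalerA [a * _]mulrC -scalerA -scalerDr; congr (_ *: _).
by rewrite scalerBr [_ *: (_ + w)]scalerDr opprD addrACA !scalerA [a * _]mulrC.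
Qed.

Lemma orbomega_linear a v w : orbomega (a *: v + w) = a *: orbomega v + orbomega w.
Proof. by apply/ffunP => s; rewrite !ffunE. Qed.

Lemma orbY_linear i a v w : orbY i (a *: v + w) = a *: orbY i v + orbY i w.
Proof.
have fT (s : seq 'I_n) u u' : foldr (fun k => orbT k (ordS k)) (a *: u + u') s
    = a *: foldr (fun k => orbT k (ordS k)) u s + foldr (fun k => orbT k (ordS k)) u' s.
  by elim: s => //= k s ->; rewrite orbT_linear.
have fTi (s : seq 'I_n) u u' : foldr (fun k => orbTinv k (ordS k)) (a *: u + u') s
    = a *: foldr (fun k => orbTinv k (ordS k)) u s
      + foldr (fun k => orbTinv k (ordS k)) u' s.
  by elim: s => //= k s ->; rewrite orbTinv_linear.
by rewrite /orbY fT orbomega_linear fTi scalerDr !scalerA mulrC.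
Qed.

Lemma orbv_linear a f g : orbv (a *: f + g) = iota a%:MP *: orbv f + orbv g.
Proof. by apply/ffunP => s; rewrite !ffunE symv_linear. Qed.

Lemma orbv0 : orbv 0 = 0.
Proof. by apply/ffunP => s; rewrite !ffunE symvE msym0 rmorph0. Qed.

Lemma orbvZ a f : orbv (a *: f) = iota a%:MP *: orbv f.
Proof. by rewrite -[a *: f]addr0 orbv_linear orbv0 addr0. Qed.

Lemma orbv_demT i j f : i != j -> orbv (demT t i j f) = orbT i j (orbv f).
Proof. by move=> ij; apply/ffunP => s; rewrite !ffunE symv_demT. Qed.

Lemma iotaV a : iota a^-1%:MP = (iota a%:MP)^-1.
Proof. exact: (fmorphV (iota \o @mpolyC n K)). Qed.

Lemma iotaX a k : iota (a ^+ k)%:MP = (iota a%:MP) ^+ k.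
Proof. exact: (rmorphXn (iota \o @mpolyC n K)). Qed.

Lemma orbv_demTinv i j f : i != j -> orbv (demTinv t i j f) = orbTinv i j (orbv f).
Proof.
move=> ij; rewrite demTinvE orbvZ iotaV /orbTinv; congr (_ *: _).
rewrite addrC -scaleNr orbv_linear orbv_demT // addrC; congr (_ + _).
by rewrite -scaleNr; congr (_ *: _); rewrite mpolyCN rmorphN mpolyCB rmorphB rmorph1.
Qed.

(** At [q = 1] the operator [omega] merely permutes the variables, so it acts on orbits. *)
Lemma orbv_omega f : orbv (omegaK 1 f) = orbomega (orbv f).
Proof.
have -> : omegaK 1 f = msym (perm (@ord_pred_inj n)) f.
  rewrite -msub_perm; apply: eq_msub => i; first by case: ifP.
  by rewrite permE.
by apply/ffunP => s; rewrite !ffunE symv_msym.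
Qed.

Lemma orbv_YopK i f : orbv (YopK 1 t i f) = orbY i (orbv f).
Proof.
rewrite /YopK /orbY orbvZ iotaV iotaX; congr (_ *: _).
have neqS (k : 'I_n) : (k.+1 < n)%N -> k != ordS k.
  by move=> kn; rewrite -val_eqE /= modn_small // neq_ltn leqnn.
have fTi (s : seq 'I_n) u : all (fun k : 'I_n => (k.+1 < n)%N) s ->
    orbv (foldr (fun k => demTinv t k (ordS k)) u s)
    = foldr (fun k => orbTinv k (ordS k)) (orbv u) s.
  elim: s => //= k s IH /andP[kn /IH <-].
  by rewrite orbv_demTinv // neqS.
have fT (s : seq 'I_n) u : all (fun k : 'I_n => (k.+1 < n)%N) s ->
    orbv (foldr (fun k => demT t k (ordS k)) u s)
    = foldr (fun k => orbT k (ordS k)) (orbv u) s.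
  elim: s => //= k s IH /andP[kn /IH <-].
  by rewrite orbv_demT // neqS.
rewrite fTi; last by apply/allP => k; rewrite mem_filter => /andP[/andP[]].
rewrite orbv_omega fT //; apply/allP => k; rewrite mem_filter => /andP[ki _].
exact: leq_ltn_trans ki (ltn_ord i).
Qed.

Variable F : 'S_n -> {mpoly K[n]}.
Hypothesis F_neq0 : forall s, F s != 0.
Hypothesis F_eigen : forall s i, YopK 1 t i (F s) = t ^- s i *: F s.
Hypothesis tX_inj : forall a b, t ^- a = t ^- b -> a = b.

(** The orbit vectors of the [F s] are [n!] joint eigenvectors with distinct eigenvalues in a space
    of dimension [n!]. The resulting scalar [c] lies in [L] and is the same for all [s]. *)
Lemma orbv_dim1 (s0 : 'S_n) P : (forall i, YopK 1 t i P = t ^- s0 i *: P) ->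
  exists c, forall s, symv iota s P = c * symv iota s (F s0).
Proof.
move=> YP; pose b (s : 'S_n) : V := [ffun r => ((r == s)%:R : L^o)].
have span v : v = \sum_s v s *: b s.
  apply/ffunP => r; rewrite sum_ffunE (bigD1 r) //= big1 => [|s sr].
    by rewrite !ffunE eqxx addr0 [_ *: _]mulr1.
  by rewrite !ffunE eq_sym (negbTE sr) scaler0.
have [] := @joint_eigenspace_dim1 L V 'I_n 'S_n 'S_n orbY
  (fun s i => iota (t ^- s i)%:MP) (fun s => orbv (F s)) orbY_linear
  _ _ _ (erefl _) b (fun s r => orbv (F s) r) (fun s => span _)
  (orbv P) (fun r => orbv P r) s0 (span _).
- by move=> i s; rewrite -orbv_YopK F_eigen orbvZ.
- move=> s; apply: contra (F_neq0 s) => /eqP/ffunP/(_ 1%g); rewrite !ffunE => E.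
  by apply/eqP/(symv_inj iota_inj); rewrite E symvE msym0 rmorph0.
- move=> s s' E; apply/permP => i; apply/val_inj/tX_inj.
  exact: (fmorph_inj (iota \o @mpolyC n K) (E i)).
- by move=> i; rewrite -orbv_YopK YP orbvZ.
move=> c cE; exists c => s.
by have /ffunP/(_ s) := cE; rewrite !ffunE.
Qed.

(** Both sides equal [c d] times the product of [F s0] and its image under [s]. *)
Lemma msym_proportional (s0 s : 'S_n) P Q : (forall i, YopK 1 t i P = t ^- s0 i *: P) ->
  (forall i, YopK 1 t i Q = t ^- s0 i *: Q) ->
  msym s P * Q = P * msym s Q.
Proof.
move=> /orbv_dim1[c cP] /orbv_dim1[d dQ].
apply: iota_inj; rewrite !rmorphM -!symvE -[P in RHS]msym1m -[Q in LHS]msym1m.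
by rewrite -!symvE !cP !dQ; ring.
Qed.

End OrbitSpace.

(** * Symmetry of a fraction through its representative *)

Lemma frac_numden (R : idomainType) (f : {fraction R}) :
  f * (\d_(generic_quotient.repr f))%:F = (\n_(generic_quotient.repr f))%:F.
Proof.
rewrite -[f in f * _]generic_quotient.reprK; move: (generic_quotient.repr f) => u.
unlock FracField.tofrac; rewrite -[LHS]FracField.pi_mul.
apply/generic_quotient.eqmodP; rewrite /= FracField.equivfE /FracField.mulf.
by rewrite !numden_Ratio ?mulr1 ?oner_neq0 ?denom_ratioP // mulrC.
Qed.

(** [perm_frac] permutes the variables in a chosen representative [M / D]; applying [s] to
    [P D = M Q] transfers the symmetry of [P / Q] to it. *)
Lemma msym_ratio (K : fieldType) n (P Q M D : {mpoly K[n]}) s :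
  Q != 0 -> D != 0 -> P * D = M * Q -> msym s P * Q = P * msym s Q ->
  (msym s M)%:F / (msym s D)%:F = P%:F / Q%:F.
Proof.
have ms0 (u : {mpoly K[n]}) : u != 0 -> msym s u != 0.
  by apply: contra => /eqP E; apply/eqP/(inj_msym s); rewrite E msym0.
move=> Q0 /ms0 D0 /(congr1 (msym s)) DE PQ.
apply/eqP; rewrite eqr_div ?tofrac_eq0 // -!tofracM tofrac_eq; apply/eqP.
apply: (mulIf (ms0 _ Q0)); move: DE; rewrite !msymM => DE.
by rewrite mulrAC -DE mulrAC PQ mulrAC.
Qed.

Lemma symmetric_frac_ratio n (P Q : {mpoly Qt[n]}) : Q != 0 ->
  (forall s, msym s P * Q = P * msym s Q) -> symmetric_frac (P%:F / Q%:F).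
Proof.
move=> Q0 PQ s; rewrite /perm_frac; have := frac_numden (P%:F / Q%:F).
have := denom_ratioP (generic_quotient.repr (P%:F / Q%:F)).
move: (\d_ _) (\n_ _) => D M D0 DE; apply: msym_ratio => //.
apply/eqP; rewrite -tofrac_eq !tofracM -DE mulrAC divfK //.
by rewrite tofrac_eq0.
Qed.

(** * The ranking of [inc(lam, phi)] *)

Section IncRank.
Variable n : nat.
Implicit Types (lam mu zeta : 'X_{1..n}).

Lemma lexi_lt_at (s s' : seq nat) k : (k < size s)%N -> size s = size s' ->
  (forall l, (l < k)%N -> nth 0%N s l = nth 0%N s' l) ->
  (nth 0%N s' k < nth 0%N s k)%N ->
  ~~ ((s : seqlexi nat) <= (s' : seqlexi nat))%O.
Proof.
elim: s s' k => [|a s IH] [|a' s'] //= [|k] ks [ss] eqs /= lt.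
  by rewrite lexi_cons negb_and; apply/orP; left; rewrite leEnat -ltnNge.
have := eqs 0%N isT => /= <-; rewrite eqhead_lexiE; apply: (IH _ k) => // l lk.
exact: (eqs l.+1).
Qed.

(** Otherwise exchanging the parts [i] and [j] would give a lexicographically smaller rearrangement
    with the same image under [phi]. *)
Lemma inc_block phi lam mu zeta (i j : 'I_n) : is_inc phi lam mu zeta ->
  (i < j)%N -> mu i = mu j -> (zeta i <= zeta j)%N.
Proof.
move=> [rz mz zmin] ij mij; rewrite leqNgt; apply/negP => lt.
pose zeta' : 'X_{1..n} := [multinom zeta (tperm i j k) | k < n].
have pz : perm_eq zeta' zeta.
  by apply/tuple_permP; exists (tperm i j); congr val; apply: eq_from_tnth => k;
     rewrite !tnth_mktuple.
have mz' : mapc phi zeta' = mu.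
  apply/mnmP => k; rewrite -mz !mnmE.
  have e := mij; rewrite -mz !mnmE in e.
  by case: tpermP => [->|->|].
have := zmin zeta' (perm_trans pz rz) mz'; apply/negP.
have sz (m : 'X_{1..n}) : size m = n by rewrite size_tuple.
have nthE (m : 'X_{1..n}) (k : 'I_n) : nth 0%N m k = m k.
  by rewrite (mnm_nth 0%N).
apply: (@lexi_lt_at _ _ i); rewrite ?sz //.
- move=> l li; have ln : (l < n)%N by exact: ltn_trans li (ltn_ord i).
  rewrite -[l]/(val (Ordinal ln)) !nthE mnmE tpermD // -val_eqE /=; lia.
- by rewrite !nthE mnmE tpermL.
Qed.

(** For [i < j], either [mu_i > mu_j], and then [zeta_i > zeta_j] as [phi] is monotone, or
    [mu_i = mu_j], and then [zeta_i <= zeta_j] by minimality. So [zeta] and [mu] order every pair of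
    positions alike. *)
Lemma rk_inc phi lam mu zeta : (forall i j, (i <= j)%N -> (phi i <= phi j)%N) ->
  is_part mu -> is_inc phi lam mu zeta -> rk zeta =1 rk mu.
Proof.
move=> phi_mono mu_part zinc i; apply: eq_card => j; rewrite !inE /beats.
have [_ mz _] := zinc.
have muE k : mu k = phi (zeta k) by rewrite -mz mnmE.
have mono a b : (zeta a <= zeta b)%N -> (mu a <= mu b)%N.
  by rewrite !muE; apply: phi_mono.
have part (a b : 'I_n) : (a < b)%N -> (mu b <= mu a)%N by move=> /ltnW; apply: mu_part.
have blk (a b : 'I_n) : (a < b)%N -> mu a = mu b -> (zeta a <= zeta b)%N.
  exact: inc_block zinc.
have := (mono i j, mono j i, (part i j, part j i), (blk i j, blk j i)).
by move=> [[[m1 m2] [p1 p2]] [b1 b2]]; move: m1 m2 p1 p2 b1 b2; lia.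
Qed.

End IncRank.

(** * Eigenfunctions for all rankings, and the conclusion *)

Lemma eigenfunctions_q1 n : exists F : 'S_n -> {mpoly Qt[n]},
  (forall s, F s != 0) /\ forall s i, YopK 1 tq1 i (F s) = tq1 ^- s i *: F s.
Proof.
suff H (s : 'S_n) : exists f : {mpoly Qt[n]},
    f != 0 /\ forall i, YopK 1 tq1 i f = tq1 ^- s i *: f.
  have [F FP] := fin_all_exists H.
  by exists F; split=> s; have [] := FP s.
(* The parts are distinct and decrease as [s i] grows, so the rank of [i] is exactly [s i]. *)
pose eta : 'X_{1..n} := [multinom (n - (s i).+1)%N | i < n].
have [E [E1 EY _ [P EP]]] := regular_nsMac_exists eta.
exists P; split.
  apply/eqP => P0; have := EP eta; rewrite E1 P0 mcoeff0 => /(spec_unique spec1)/eqP.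
  by rewrite oner_eq0.
move=> i; rewrite (Yeigen_at_q1 EP EY); congr (_^-1 *: _); congr (_ ^+ _).
rewrite /rk; have -> : [set j | beats eta i j] = s @^-1: [set j : 'I_n | (j < s i)%N].
  apply/setP => j; rewrite !inE /beats !mnmE.
  have := ltn_ord (s i); have := ltn_ord (s j).
  have [->|ij] := eqVneq i j; first by lia.
  have : val (s i) != val (s j) by rewrite val_eqE (inj_eq perm_inj).
  by move: ij; rewrite -val_eqE /=; lia.
rewrite on_card_preimset; last first.
  by exists (s^-1)%g => j _; rewrite ?permK ?permKV.
have winj : injective (widen_ord (ltnW (ltn_ord (s i)))).
  by move=> a b /(congr1 val) /= ab; apply: val_inj.
rewrite -[RHS](card_ord (s i)) -[RHS](card_imset _ winj).
apply: eq_card => j; rewrite inE; apply/idP/imsetP => [ji|[k _ ->]].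
  by exists (Ordinal ji) => //; apply: val_inj.
exact: (ltn_ord k).
Qed.

Theorem theorem4p17 (n : nat) (phi : nat -> nat) (lam mu zeta : 'X_{1..n})
    (Einc Emu : {mpoly Qqt[n]})
    (phi_mono : forall i j : nat, (i <= j)%N -> (phi i <= phi j)%N)
    (lam_part : is_part lam) (mu_part : is_part mu)
    (phi_lam : mapc phi lam = mu)
    (zeta_inc : is_inc phi lam mu zeta)
    (HEinc : is_nsMacdonald zeta Einc)
    (HEmu : is_nsMacdonald mu Emu) :
  exists P Q : {mpoly Qt[n]},
    [/\ at_q1 Einc P, at_q1 Emu Q, Q != 0
      & symmetric_frac (P%:F / Q%:F)].
Proof.
have [_ EY _ [P EP]] := nsMac_regular HEinc.
have [E1 EY' _ [Q EQ]] := nsMac_regular HEmu.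
(* The leading coefficient 1 survives the specialisation. *)
have Q0 : Q != 0.
  apply/eqP => Q0; have := EQ mu; rewrite E1 Q0 mcoeff0 => /(spec_unique spec1)/eqP.
  by rewrite oner_eq0.
exists P, Q; split => //; apply: symmetric_frac_ratio => // s.
(* The common ranking of [mu] and [zeta], as a permutation, names the joint eigenspace that contains
   both [P] and [Q]. *)
have rinj : injective (fun i => Ordinal (rk_ltn mu i)).
  by move=> i j /(congr1 val) /= /rk_inj.
have [F [F0 FY]] := eigenfunctions_q1 n.
apply: (msym_proportional (@tofrac_inj Qt n) F0 FY tq1X_inj (s0 := perm rinj)) => i.
  rewrite permE /= -(rk_inc phi_mono mu_part zeta_inc).
  exact: Yeigen_at_q1 EP EY i.
by rewrite permE /=; apply: Yeigen_at_q1 EQ EY' i.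
Qed.
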